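(* Let $q_E\colon E\to M$ be a smooth vector bundle, let $[\![\cdot,\cdot]\!]$ be a Dorfman bracket on $\Gamma(TM\oplus E^* )$ and let $\Xi\colon\Gamma(TM\oplus E^* )\to\Gamma^l_E(TE\oplus T^*E)$ be the corresponding lift. A form $\beta\in\Omega^1(M,E^* )$ defines a symmetry of $[\![\cdot,\cdot]\!]$ via $\Phi_\beta\colon(X,\epsilon)\mapsto(X,\epsilon+\mathbf i_X\beta)$, i.e. $[\![\Phi_\beta(\nu_1),\Phi_\beta(\nu_2)]\!]=\Phi_\beta[\![\nu_1,\nu_2]\!]$ for all $\nu_1,\nu_2\in\Gamma(TM\oplus E^* )$, if and only if $$\Phi_{-\mathbf d\Lambda_\beta}\circ\Xi=\Xi\circ\Phi_\beta.$$
   Context: Everything is smooth. $TM\oplus E^*$ and $E\oplus T^*M$ are paired by $\langle(X,\varepsilon),(e,\theta)\rangle=\varepsilon(e)+\theta(X)$. Dorfman bracket. An $\mathbb R$-bilinear bracket on $\Gamma(TM\oplus E^* )$ with $\mathrm{pr}_{TM}[\![\nu_1,\nu_2]\!]=[\mathrm{pr}_{TM}\nu_1,\mathrm{pr}_{TM}\nu_2]$, $[\![\nu_1,f\nu_2]\!]=f[\![\nu_1,\nu_2]\!]+(\mathrm{pr}_{TM}\nu_1)(f)\nu_2$ for $f\in C^\infty(M)$, and $[\![\nu_1,[\![\nu_2,\nu_3]\!]]\!]=[\![[\![\nu_1,\nu_2]\!],\nu_3]\!]+[\![\nu_2,[\![\nu_1,\nu_3]\!]]\!]$. For $B\in\Omega^2(E)$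 closed, $\Phi_B\colon TE\oplus T^*E\to TE\oplus T^*E$ is $\Phi_B(U,\alpha)=(U,\alpha+\mathbf i_UB)$. For $\beta\in\Omega^1(M,E^* )$, $\Lambda_\beta\in\Omega^1(E)$ is $\Lambda_\beta(e_m)=(T_{e_m}q_E)^*(\langle\beta,e\rangle(m))$ for $e\in\Gamma(E)$ with $e(m)=e_m$, where $\langle\beta,e\rangle\in\Omega^1(M)$. Lift. For $\nu=(X,\varepsilon)$ define the derivation $\mathcal D_\nu$ of $\Gamma(E\oplus T^*M)$ with symbol $X$ by $X\langle\nu',\tau\rangle=\langle\nu',\mathcal D_\nu\tau\rangle+\langle[\![\nu,\nu']\!],\tau\rangle$ for all $\nu'\in\Gamma(TM\oplus E^* )$, $\tau\in\Gamma(E\oplus T^*M)$. The lift corresponding to $[\![\cdot,\cdot]\!]$ is $$\Xi(X,\varepsilon)(e_m)=(T_me\,X(m),\mathbf d_{e_m}\ell_\varepsilon)-(\mathcal D_{(X,\varepsilon)}(e,0))^\uparrow(e_m)$$ for any $e\in\Gamma(E)$ with $e(m)=e_m$, where $\ell_\varepsilon\in C^\infty(E)$ is the linear function $e_m\mapsto\langle\varepsilon(m),e_m\rangle$ and $(e,\theta)^\uparrow(e'_m)=\big(\frac{d}{dt}|_{t=0}(e'_m+te(m)),(T_{e'_m}q_E)^*\theta(m)\big)$. It takes values in the space $\Gamma^l_E(TE\oplus T^*E)$ of linear sections of $TE\oplus T^*E\to E$ (sections that are vector bundle morphisms from $E\to M$ to $TE\oplus T^*E\to TM\oplus E^*$ over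 a section of $TM\oplus E^*\to M$). *)

(* Defs.v *)
From HB Require Import structures.
From mathcomp Require Import all_boot all_order all_algebra.
From mathcomp Require Import mathcomp_extra boolp classical_sets functions.
From mathcomp Require Import cardinality reals interval_inference topology.
From mathcomp Require Import normedtype landau derive ring.

Set Implicit Arguments.
Unset Strict Implicit.
Unset Printing Implicit Defensive.

Import Order.TTheory GRing.Theory Num.Theory.
Import numFieldNormedType.Exports.

Local Open Scope classical_set_scope.
Local Open Scope ring_scope.

Section Ck_def.
Context {R : realType} {V W : normedModType R}.

(* C^k on U, for U open: continuity and differentiability are those of f at
   the points of U. *)
Fixpoint Ck (k : nat) (U : set V) (f : V -> W) : Prop :=
  if k is k'.+1 then
    (forall x, U x -> differentiable f x) /\ (forall v, Ck k' U ('D_v f))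
  else forall x, U x -> {for x, continuous f}.

Definition smooth_on (U : set V) (f : V -> W) := forall k, Ck k U f.

End Ck_def.

Section Ck_theory.
Context {R : realType}.

Lemma near_eq_differentiable {V W : normedModType R} (f g : V -> W) x :
  (\near x, f x = g x) -> differentiable g x -> differentiable f x.
Proof.
move=> fg dg.
have fx : f x = g x by exact: nbhs_singleton fg.
have E : (f - g) \o shift x = cst ((f - g) x) + (\0 : {linear V -> W}) +o_ 0 id.
  apply/eqaddoP => _/posnumP[e].
  have fg0 : \forall y \near (0 : V), f (y + x) = g (y + x).
    by move: fg; rewrite (near_shift 0) subr0.
  near=> y.
  have fgy : f (y + x) = g (y + x) by near: y.
  have -> : ((f - g) \o shift x - (cst ((f - g) x) + \0)) y = 0.
    rewrite /GRing.add /GRing.opp /=  fgy fx.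
    by rewrite !subrr addr0 subrr.
  by rewrite normr0 mulr_ge0.
have dh : differentiable (f - g) x.
  have c0 : continuous (\0 : V -> W) by exact: cst_continuous.
  apply/diff_locallyP.
  by rewrite (diff_unique (df := \0 : {linear V -> W}) c0 E).
by rewrite -(subrK g f); exact: differentiableD.
Unshelve. all: by end_near. Qed.

Lemma Ck_local {V W : normedModType R} k (U : set V) (f g : V -> W) :
  (forall x, U x -> exists U' : set V,
      [/\ open U', U' x, (forall y, U' y -> f y = g y) & Ck k U' g]) ->
  Ck k U f.
Proof.
elim: k f g => [|k IH] f g h /=.
  move=> x /h[U' [oU' U'x fg cg]].
  have e : \near x, g x = f x.
    near=> y; apply/esym/fg.
    by near: y; exact: open_nbhs_nbhs.
  have : f @ x --> g x by apply: (cvg_trans _ (cg x U'x)); exact: near_eq_cvg.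
  by rewrite -(fg _ U'x).
have near_fg x U' : open U' -> U' x -> (forall y, U' y -> f y = g y) ->
    \near x, f x = g x.
  move=> oU' U'x fg; near=> y; apply/fg.
  by near: y; exact: open_nbhs_nbhs.
split=> [x /h[U' [oU' U'x fg [dg _]]]|v].
  exact: near_eq_differentiable (near_fg _ _ oU' U'x fg) (dg _ U'x).
apply: (IH _ ('D_v g)) => x /h[U' [oU' U'x fg [_ dg]]].
exists U'; split=> [//|//|y U'y|]; last exact: dg.
exact: near_eq_derive (near_fg _ _ oU' U'y fg).
Unshelve. all: by end_near. Qed.

Lemma CkW {V W : normedModType R} k (U : set V) (f : V -> W) :
  Ck k.+1 U f -> Ck k U f.
Proof.
elim: k f => [|k IH] f [df Df].
  by move=> x /df /differentiable_continuous.
by split=> // v; exact/IH.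
Qed.

Lemma Ck_ext {V W : normedModType R} k (U : set V) (f g : V -> W) :
  open U -> (forall x, U x -> f x = g x) -> Ck k U g -> Ck k U f.
Proof. by move=> oU fg gU; apply: (@Ck_local _ _ _ _ _ g) => x Ux; exists U. Qed.

Lemma Ck_sub {V W : normedModType R} k (U U' : set V) (f : V -> W) :
  U `<=` U' -> Ck k U' f -> Ck k U f.
Proof.
move=> UU'; elim: k f => [|k IH] f /=; first by move=> cf x /UU' /cf.
by move=> [df Df]; split=> [x /UU' /df|v]; [|exact/IH].
Qed.

Lemma Ck_cst {V W : normedModType R} k (U : set V) (a : W) : Ck k U (cst a).
Proof.
elim: k a => [|k IH] a /=; first by move=> x _; exact: cst_continuous.
split=> [x _|v]; first exact: differentiable_cst.
by rewrite (_ : 'D_v (cst a) = cst 0)//; apply/funext => x; rewrite derive_cst.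
Qed.

Lemma CkD {V W : normedModType R} k (U : set V) (f g : V -> W) :
  open U -> Ck k U f -> Ck k U g -> Ck k U (f \+ g).
Proof.
move=> oU; elim: k f g => [|k IH] f g /=.
  by move=> cf cg x Ux; apply: continuousD; [exact: cf|exact: cg].
move=> [df Df] [dg Dg]; split=> [x Ux|v].
  by apply: differentiableD; [exact: df|exact: dg].
apply: (Ck_ext (g := 'D_v f \+ 'D_v g)) (IH _ _ (Df v) (Dg v)) => // x Ux.
by rewrite deriveD//; apply: diff_derivable; [exact: df|exact: dg].
Qed.

Lemma CkZ {V W : normedModType R} k (U : set V) (a : R) (f : V -> W) :
  open U -> Ck k U f -> Ck k U (a \*: f).
Proof.
move=> oU; elim: k f => [|k IH] f /=.
  by move=> cf x Ux; apply: cvgZl_tmp; exact: cf.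
move=> [df Df]; split=> [x Ux|v].
  by apply: differentiableZ; exact: df.
apply: (Ck_ext (g := a \*: 'D_v f)) (IH _ (Df v)) => // x Ux.
by rewrite deriveZ//; apply: diff_derivable; exact: df.
Qed.

Lemma CkM {V : normedModType R} k (U : set V) (f g : V -> R) :
  open U -> Ck k U f -> Ck k U g -> Ck k U (f \* g).
Proof.
move=> oU; elim: k f g => [|k IH] f g.
 by move=> cf cg x Ux; exact: (cvgM (cf x Ux) (cg x Ux)).
move=> Cf Cg; have [df Df] := Cf; have [dg Dg] := Cg; split=> [x Ux|v].
  exact: (differentiableM (df x Ux) (dg x Ux)).
apply: (Ck_ext (g := (f \* 'D_v g) \+ (g \* 'D_v f))) => // [x Ux|].
  by rewrite deriveM//; apply: diff_derivable; auto.
by apply: CkD => //; apply: IH; [exact: CkW|exact: Dg|exact: CkW|exact: Df].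
Qed.

Lemma Ck_sum {V W : normedModType R} k (U : set V) m (f : 'I_m -> V -> W) :
  open U -> (forall i, Ck k U (f i)) ->
  Ck k U (fun x => \sum_(i < m) f i x).
Proof.
move=> oU Cf; elim: m f Cf => [|m IH] f Cf.
  rewrite (_ : (fun _ => _) = cst 0); first exact: Ck_cst.
  by apply/funext => x; rewrite big_ord0.
rewrite (_ : (fun _ => _) = f ord0 \+ (fun x => \sum_(i < m) f (lift ord0 i) x)).
  by apply: CkD => //; exact: IH.
by apply/funext => x; rewrite big_ord_recl.
Qed.

Lemma diff_coordE {V : normedModType R} m (g : V -> 'rV[R]_m) x v i :
  differentiable g x ->
  differentiable (fun y => g y ord0 i) x /\
  'D_v (fun y => g y ord0 i) x = 'D_v g x ord0 i.
Proof.
move=> dg.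
pose pr := fun M : 'rV[R]_m => M ord0 i.
have dp : differentiable (pr : _ -> R) (g x) by exact: differentiable_coord.
have pr_lin : linear (pr : _ -> R^o) by move=> a u w; rewrite /pr !mxE.
pose prL := GRing.isLinear.Build _ _ _ _ _ pr_lin.
pose P : {linear 'rV[R]_m -> R^o} := HB.pack pr prL.
have dc : differentiable (pr \o g) x by exact: differentiable_comp.
split=> //.
have cP : continuous P by move=> y; exact/differentiable_continuous/differentiable_coord.
by rewrite -[LHS]/('D_v (pr \o g) x) !deriveE// diff_comp//= (diff_lin _ cP).
Qed.

Lemma Ck_coord {V : normedModType R} k (U : set V) m (g : V -> 'rV[R]_m) i :
  open U -> Ck k U g -> Ck k U (fun y => g y ord0 i).
Proof.
move=> oU; elim: k g => [|k IH] g.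
  move=> cg x Ux.
  exact: (continuous_comp (cg x Ux) (@coord_continuous _ _ _ ord0 i (g x))).
move=> [dg Dg]; split=> [x Ux|v].
  by have [] := diff_coordE 0 i (dg x Ux).
apply: Ck_ext (IH _ (Dg v)) => // x Ux.
by have [] := diff_coordE v i (dg x Ux).
Qed.

Lemma Ck_comp {V : normedModType R} m k (U : set V) (U' : set 'rV[R]_m)
    (g : V -> 'rV[R]_m) (f : 'rV[R]_m -> R) :
  open U -> (forall x, U x -> U' (g x)) ->
  Ck k U g -> Ck k U' f -> Ck k U (f \o g).
Proof.
move=> oU gU; elim: k f => [|k IH] f.
  move=> cg cf x Ux.
  exact: (continuous_comp (cg x Ux) (cf _ (gU x Ux))).
move=> Cg [df Df]; have [dg Dg] := Cg; split=> [x Ux|v].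
  by apply: differentiable_comp; [exact: dg|exact/df/gU].
apply: (Ck_ext (g := fun x =>
  \sum_(i < m) 'D_v g x ord0 i * 'D_(delta_mx ord0 i) f (g x))) => //.
  move=> x Ux.
  have dgx := dg x Ux; have dfx := df _ (gU x Ux).
  rewrite deriveE; last exact: differentiable_comp.
  rewrite diff_comp//= -(deriveE v dgx) {1}(row_sum_delta ('D_v g x)) linear_sum.
  by apply: eq_bigr => i _; rewrite linearZ/= -deriveE.
apply: (Ck_sum (f := fun i x =>
  'D_v g x ord0 i * 'D_(delta_mx ord0 i) f (g x))) => // i.
apply: CkM => //; first exact: Ck_coord oU (Dg v).
exact: (IH _ (CkW Cg) (Df _)).
Qed.

End Ck_theory.

Section manifold_def.
Context {R : realType}.

(* A chart is total on both sides; only its restriction to cdom matters. *)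
Record chart (T : Type) (n : nat) := Chart {
  cdom : set T;
  cfun : T -> 'rV[R]_n;
  cinv : 'rV[R]_n -> T }.

Definition cimg T n (c : chart T n) : set 'rV[R]_n := cfun c @` cdom c.

Definition is_chart (T : topologicalType) n (c : chart T n) :=
  [/\ open (cdom c), open (cimg c),
      forall p, cdom c p -> cinv c (cfun c p) = p,
      forall p, cdom c p -> {for p, continuous (cfun c)} &
      forall x, cimg c x -> {for x, continuous (cinv c)}].

Definition compatible T n (c d : chart T n) :=
  smooth_on (cfun c @` (cdom c `&` cdom d)) (cfun d \o cinv c) /\
  smooth_on (cfun d @` (cdom c `&` cdom d)) (cfun c \o cinv d).

Record manifold_on (T : topologicalType) (n : nat) := ManifoldOn {
  atlas : set (chart T n);
  atlas_chart : forall c, atlas c -> is_chart c;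
  atlas_cover : forall p, exists2 c, atlas c & cdom c p;
  atlas_compat : forall c d, atlas c -> atlas d -> compatible c d;
  mfd_hausdorff : hausdorff_space T;
  mfd_second_countable : @second_countable T }.

Record manifold (n : nat) := Manifold {
  mfd_carrier :> topologicalType;
  mfd_struct : manifold_on mfd_carrier n }.

Definition charts n (M : manifold n) : set (chart M n) := atlas (mfd_struct M).

Definition smooth_fun n (M : manifold n) (f : M -> R) :=
  forall c, charts c -> smooth_on (cimg c) (f \o cinv c).

Definition smooth_map n m (M : manifold n) (N : manifold m) (F : M -> N) :=
  continuous F /\
  forall (c : chart M n) (d : chart N m), charts c -> charts d ->
    smooth_on (cfun c @` (cdom c `&` F @^-1` cdom d)) (cfun d \o F \o cinv c).

End manifold_def.
Arguments chart : clear implicits.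
Arguments manifold_on : clear implicits.
Arguments manifold : clear implicits.

Section smooth_functions.
Context {R : realType}.

Lemma chart_openI (T : topologicalType) n (c : chart R T n) (A : set T) :
  is_chart c -> open A -> open (cfun c @` (cdom c `&` A)).
Proof.
move=> [oD oI cK cC iC] oA; rewrite openE => x [p [cp Ap] <-{x}].
have Ix : cimg c (cfun c p) by exists p.
have nA : nbhs (cfun c p) (cinv c @^-1` A).
  by apply: (iC _ Ix); rewrite cK//; exact: open_nbhs_nbhs.
have nI : nbhs (cfun c p) (cimg c) by exact: open_nbhs_nbhs.
apply: filterS (filterI nA nI) => x [/= Ax [q cq qx]].
by exists q => //; split=> //; rewrite -(cK q cq) qx.
Qed.

Lemma smooth_fun_chart n (M : manifold R n) (f : M -> R) (c : chart R M n) :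
  smooth_fun f -> is_chart c -> (forall d, charts d -> compatible c d) ->
  smooth_on (cimg c) (f \o cinv c).
Proof.
move=> sf hc cd k; have [oD oI cK cC iC] := hc.
apply: (Ck_local (g := f \o cinv c)) => _ [p cp <-].
have [d ad dp] := atlas_cover (mfd_struct M) p.
have [od oId dK dC idC] := atlas_chart ad.
have oU : open (cfun c @` (cdom c `&` cdom d)) by exact: chart_openI.
exists (cfun c @` (cdom c `&` cdom d)); split=> //; first by exists p.
apply: (Ck_ext (g := (f \o cinv d) \o (cfun d \o cinv c))) => //.
  by move=> _ [q [cq dq] <-] /=; rewrite !cK// dK.
apply: (Ck_comp (U' := cimg d)) => //.
- by move=> _ [q [cq dq] <-] /=; rewrite cK//; exists q.
- by have [h _] := cd _ ad; exact: h.
- exact: sf.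
Qed.

Lemma smooth_fun_comp n m (M : manifold R n) (N : manifold R m) (F : M -> N)
    (f : N -> R) :
  smooth_map F -> smooth_fun f -> smooth_fun (f \o F).
Proof.
move=> [cF sF] sf c ac k; have hc := atlas_chart ac.
have [oD oI cK cC iC] := hc.
apply: (Ck_local (g := (f \o F) \o cinv c)) => _ [p cp <-].
have [d ad dp] := atlas_cover (mfd_struct N) (F p).
have [od oId dK dC idC] := atlas_chart ad.
have oU : open (cfun c @` (cdom c `&` F @^-1` cdom d)).
  by apply: chart_openI => //; apply: open_comp.
exists (cfun c @` (cdom c `&` F @^-1` cdom d)); split=> //; first by exists p.
apply: (Ck_ext (g := (f \o cinv d) \o (cfun d \o F \o cinv c))) => //.
  by move=> _ [q [cq dq] <-] /=; rewrite !cK// dK.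
apply: (Ck_comp (U' := cimg d)) => //.
- by move=> _ [q [cq dq] <-] /=; rewrite cK//; exists (F q).
- exact: sF.
- exact: sf.
Qed.

End smooth_functions.

Section Cinf.
Context {R : realType} {n : nat}.
Variable M : manifold R n.

Definition smoothb : {pred M -> R} := fun f => `[< smooth_fun f >].

Record Cinf := MkCinf {
  Cinf_fun :> M -> R;
  Cinf_smooth : smoothb Cinf_fun }.

HB.instance Definition _ := [isSub of Cinf for Cinf_fun].
HB.instance Definition _ := [Choice of Cinf by <:].

Lemma CinfP (f : Cinf) : smooth_fun f.
Proof. by apply/asboolP; case: f. Qed.

Definition mkCinf (f : M -> R) (hf : smooth_fun f) : Cinf :=
  MkCinf (introT (asboolP _) hf).

Let img_open c : charts c -> open (@cimg R M n c).
Proof. by case/atlas_chart. Qed.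

Let subring : subring_closed smoothb.
Proof.
split.
- by apply/asboolP => c ac k; exact: Ck_cst.
- move=> f g /asboolP sf /asboolP sg; apply/asboolP => c ac k.
  apply: (@Ck_ext _ _ _ _ _ _ ((f \o cinv c) \+ ((-1) \*: (g \o cinv c)))).
  + exact: img_open.
  + by move=> x _ /=; rewrite scaleN1r.
  + apply: CkD; [exact: img_open|exact: sf|].
    by apply: CkZ; [exact: img_open|exact: sg].
- move=> f g /asboolP sf /asboolP sg; apply/asboolP => c ac k.
  by apply: (@CkM _ _ _ _ (f \o cinv c) (g \o cinv c));
    [exact: img_open|exact: sf|exact: sg].
Qed.

HB.instance Definition _ := GRing.isSubringClosed.Build _ smoothb subring.
HB.instance Definition _ := 
  GRing.SubChoice_isSubComPzRing.Build _ _ Cinf (GRing.subringClosedP smoothb).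

Let scale_closed : scaler_closed smoothb.
Proof.
move=> a f /asboolP sf; apply/asboolP => c ac k.
by apply: (@CkZ _ _ _ _ _ a (f \o cinv c)); [exact: img_open|exact: sf].
Qed.

HB.instance Definition _ :=
  GRing.isScaleClosed.Build R (M -> R) smoothb scale_closed.
HB.instance Definition _ := [SubZmodule_isSubLmodule of Cinf by <:].

End Cinf.
Arguments mkCinf {R n M f}.

Section dual.
Context {R : realType}.
Variable V : lmodType R.

Definition linearb : {pred V -> R} := fun u => `[< scalar u >].

Record dual := Dual { dual_fun :> V -> R; dual_linear : linearb dual_fun }.

HB.instance Definition _ := [isSub of dual for dual_fun].
HB.instance Definition _ := [Choice of dual by <:].

Let linearb_closed : subsemimod_closed linearb.
Proof.
split; first split.
- by apply/asboolP => a u v /=; rewrite mulr0 addr0.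
- move=> f g /asboolP lf /asboolP lg; apply/asboolP => a u v /=.
  by rewrite /GRing.add/= lf lg mulrDr addrACA.
- move=> b f /asboolP lf; apply/asboolP => a u v.
  rewrite /GRing.scale/= lf scalerDr; congr (_ + _); exact: mulrCA.
Qed.

HB.instance Definition _ :=
  GRing.isSubmodClosed.Build R (V -> R) linearb linearb_closed.
HB.instance Definition _ := [SubChoice_isSubLmodule of dual by <:].

Lemma dualP (u : dual) : scalar u.
Proof. by have /asboolP := dual_linear u. Qed.

HB.instance Definition _ (u : dual) :=
  GRing.isLinear.Build R V R *%R (dual_fun u) (dualP u).

Definition mkDual (u : V -> R) (hu : scalar u) : dual :=
  Dual (introT (asboolP _) hu).

End dual.
Arguments mkDual {R V u}.

Section tangent.
Context {R : realType} {n : nat} {M : manifold R n}.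
Variable p : M.

(* Tangent vectors at p are the derivations at p of C^oo(M). *)
Definition is_derivation (v : Cinf M -> R) :=
  scalar v /\ forall f g, v (f * g) = v f * g p + f p * v g.

Definition derivationb : {pred Cinf M -> R} := fun v => `[< is_derivation v >].

Record tangent := Tangent {
  tangent_fun :> Cinf M -> R;
  tangent_derivation : derivationb tangent_fun }.

HB.instance Definition _ := [isSub of tangent for tangent_fun].
HB.instance Definition _ := [Choice of tangent by <:].

Let derivationb_closed : subsemimod_closed derivationb.
Proof.
split; first split.
- apply/asboolP; split => [a f g|f g] /=; first by rewrite mulr0 addr0.
  by rewrite mul0r mulr0 addr0.
- move=> v w /asboolP[lv Lv] /asboolP[lw Lw]; apply/asboolP.
  split => [a f g|f g] /=; rewrite /GRing.add/=.
    by rewrite lv lw mulrDr addrACA.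
  by rewrite Lv Lw mulrDl mulrDr addrACA.
- move=> b v /asboolP[lv Lv]; apply/asboolP.
  split => [a f g|f g]; rewrite /GRing.scale/=.
    by rewrite lv scalerDr; congr (_ + _); exact: mulrCA.
  rewrite Lv scalerDr; congr (_ + _); first exact: mulrA.
  exact: mulrCA.
Qed.

HB.instance Definition _ :=
  GRing.isSubmodClosed.Build R (Cinf M -> R) derivationb derivationb_closed.
HB.instance Definition _ := [SubChoice_isSubLmodule of tangent by <:].

Lemma tangentP (v : tangent) : is_derivation v.
Proof. by have /asboolP := tangent_derivation v. Qed.

HB.instance Definition _ (v : tangent) :=
  GRing.isLinear.Build R (Cinf M) R *%R (tangent_fun v) (tangentP v).1.

Definition mkTangent (v : Cinf M -> R) (hv : is_derivation v) : tangent :=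
  Tangent (introT (asboolP _) hv).

Definition cotangent := dual tangent.

Lemma ev_scalar (f : Cinf M) : scalar (fun v : tangent => v f).
Proof. by []. Qed.

(* The differential d_p f. *)
Definition diff_at (f : Cinf M) : cotangent := mkDual (ev_scalar f).

End tangent.
Arguments cotangent {R n M}.

Section pushforward.
Context {R : realType} {n m : nat} {M : manifold R n} {N : manifold R m}.
Variables (F : M -> N) (sF : smooth_map F).

Definition comp_Cinf (f : Cinf N) : Cinf M :=
  mkCinf (smooth_fun_comp sF (CinfP f)).

Lemma comp_CinfD a f g :
  comp_Cinf (a *: f + g) = a *: comp_Cinf f + comp_Cinf g.
Proof. exact: val_inj. Qed.

Lemma comp_CinfM f g : comp_Cinf (f * g) = comp_Cinf f * comp_Cinf g.
Proof. exact: val_inj. Qed.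

Lemma push_derivation p (v : tangent p) :
  is_derivation (F p) (fun f : Cinf N => v (comp_Cinf f)).
Proof.
have [lv Lv] := tangentP v.
by split=> [a f g|f g]; rewrite ?comp_CinfD ?comp_CinfM ?lv ?Lv.
Qed.

(* T_p F. *)
Definition push p (v : tangent p) : tangent (F p) := mkTangent (push_derivation v).

Lemma pull_scalar p (th : cotangent (F p)) :
  scalar (fun v : tangent p => th (push v)).
Proof.
move=> a u v; rewrite -[RHS]/(a * th (push u) + th (push v)) -linearP.
by congr (th _); exact: val_inj.
Qed.

(* (T_p F)^*. *)
Definition pull p (th : cotangent (F p)) : cotangent p := mkDual (pull_scalar th).

End pushforward.

Section fields_and_forms.
Context {R : realType} {n : nat}.
Variable M : manifold R n.

Record vfield := VField {
  vf_fun :> forall p : M, tangent p;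
  vf_smooth : forall f : Cinf M, smooth_fun (fun p => vf_fun p f) }.

(* Smoothness of vector fields and forms is tested on smooth functions and
   vector fields. *)
Record form1 := Form1 {
  form1_fun :> forall p : M, cotangent p;
  form1_smooth : forall X : vfield, smooth_fun (fun p => form1_fun p (X p)) }.

Record form2 := Form2 {
  form2_fun :> forall p : M, {linear tangent p -> cotangent p};
  form2_alt : forall p (v : tangent p), form2_fun p v v = 0;
  form2_smooth : forall X Y : vfield,
    smooth_fun (fun p => form2_fun p (X p) (Y p)) }.

Definition vf_act (X : vfield) (f : Cinf M) : Cinf M := mkCinf (vf_smooth X f).
Definition form1_app (th : form1) (X : vfield) : Cinf M :=
  mkCinf (form1_smooth th X).

Lemma lie_derivation (X Y : vfield) p :
  is_derivation p (fun f => X p (vf_act Y f) - Y p (vf_act X f)).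
Proof.
have actD (Z : vfield) a f g :
    vf_act Z (a *: f + g) = a *: vf_act Z f + vf_act Z g.
  by apply/val_inj/funext => q /=; rewrite (tangentP (Z q)).1.
have actM (Z : vfield) f g : vf_act Z (f * g) = vf_act Z f * g + f * vf_act Z g.
  by apply/val_inj/funext => q /=; rewrite (tangentP (Z q)).2.
have [lX LX] := tangentP (X p); have [lY LY] := tangentP (Y p).
split=> [a f g|f g].
  by rewrite !actD lX lY mulrBr opprD addrACA.
rewrite !actM !linearD/= !LX !LY /=.
by ring.
Qed.

Lemma lie_smooth (X Y : vfield) (f : Cinf M) :
  smooth_fun (fun p => mkTangent (lie_derivation X Y p) f).
Proof. exact: (CinfP (vf_act X (vf_act Y f) - vf_act Y (vf_act X f))). Qed.

Definition lie (X Y : vfield) : vfield := VField (lie_smooth X Y).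

Lemma vfD_smooth (X Y : vfield) (f : Cinf M) :
  smooth_fun (fun p => (X p + Y p) f).
Proof. exact: (CinfP (vf_act X f + vf_act Y f)). Qed.
Definition vfD (X Y : vfield) := VField (vfD_smooth X Y).

Lemma vfZ_smooth (g : Cinf M) (X : vfield) (f : Cinf M) :
  smooth_fun (fun p => (g p *: X p) f).
Proof. exact: (CinfP (g * vf_act X f)). Qed.
Definition vfZ (g : Cinf M) (X : vfield) := VField (vfZ_smooth g X).

Lemma form1_0_smooth (X : vfield) :
  smooth_fun (fun p => (0 : cotangent p) (X p)).
Proof. exact: (CinfP (0 : Cinf M)). Qed.
Definition form1_0 := Form1 form1_0_smooth.

Lemma form2N_alt (B : form2) p (v : tangent p) : (\- B p) v v = 0.
Proof.
rewrite -[LHS]/((- B p v) v) -[LHS]/(- (B p v v) : R) form2_alt.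
exact: oppr0.
Qed.
Lemma form2N_smooth (B : form2) (X Y : vfield) :
  smooth_fun (fun p => (\- B p) (X p) (Y p)).
Proof. exact: (CinfP (- mkCinf (form2_smooth B X Y))). Qed.
Definition form2N (B : form2) : form2 :=
  @Form2 (fun p => \- B p) (form2N_alt B) (form2N_smooth B).

(* dL is the exterior derivative of L; vector fields extending given tangent
   vectors exist, so this determines dL. *)
Definition is_extd (L : form1) (dL : form2) := forall (X Y : vfield) p,
  dL p (X p) (Y p) =
  X p (form1_app L Y) - Y p (form1_app L X) - L p (lie X Y p).

End fields_and_forms.

Section vector_bundle.
Context {R : realType} {n : nat}.

Record trivialization (T : Type) (fib : T -> lmodType R) (r : nat) := Triv {
  tdom : set T;
  tfun : forall m : T, {linear fib m -> 'rV[R]_r};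
  tinv : forall m : T, 'rV[R]_r -> fib m }.

Definition triv_chart (T : Type) (fib : T -> lmodType R) (r : nat)
    (c : chart R T n) (t : trivialization fib r) :
    chart R {m : T & fib m} (n + r) :=
  Chart [set p | cdom c (projT1 p) /\ tdom t (projT1 p)]
    (fun p => row_mx (cfun c (projT1 p)) (tfun t (projT1 p) (projT2 p)))
    (fun w => existT _ (cinv c (lsubmx w)) (tinv t (cinv c (lsubmx w)) (rsubmx w))).

(* (U, phi) is a local trivialization, i.e. phi : q^-1(U) -> U x R^r is a
   diffeomorphism, iff for every chart c of M the map (c o q, phi) is a chart of
   the total space compatible with its atlas. *)
Record vbundle (M : manifold R n) (r : nat) := VBundle {
  fib : M -> lmodType R;
  tot_topology : Topological.axioms_ {m : M & fib m};
  tot_struct : manifold_on R (Topological.Pack tot_topology) (n + r);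
  vb_proj_smooth :
    smooth_map (M := Manifold tot_struct) (N := M) (@projT1 M fib);
  vb_trivial : forall m : M, exists t : trivialization fib r,
    [/\ open (tdom t), tdom t m,
        forall x, tdom t x -> cancel (tfun t x) (tinv t x) /\
                              cancel (tinv t x) (tfun t x) &
        forall c, charts c ->
          @is_chart R (Topological.Pack tot_topology) _ (triv_chart c t) /\
          forall d, atlas tot_struct d -> compatible (triv_chart c t) d] }.

Definition tot M r (E : vbundle M r) : manifold R (n + r) :=
  Manifold (tot_struct E).

End vector_bundle.

Section derive1_lemmas.
Context {R : realType}.
Implicit Types F G : R -> R.

Lemma derive1_lin a F G : derivable F 0 1 -> derivable G 0 1 ->
  derive1 (fun t => a * F t + G t) 0 = a * derive1 F 0 + derive1 G 0.
Proof.
move=> dF dG; rewrite !derive1E.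
rewrite (_ : (fun _ => _) = (a \*: F) \+ G)//.
by rewrite (deriveD (@derivableZ _ _ _ F a 0 1 dF) dG) (deriveZ a dF).
Qed.

Lemma derive1_mul F G : derivable F 0 1 -> derivable G 0 1 ->
  derive1 (fun t => F t * G t) 0 = derive1 F 0 * G 0 + F 0 * derive1 G 0.
Proof.
move=> dF dG; rewrite !derive1E.
rewrite (_ : (fun _ => _) = F \* G)//.
rewrite (deriveM dF dG) addrC; congr (_ + _); exact: mulrC.
Qed.

End derive1_lemmas.

Section bundle_geometry.
Context {R : realType} {n r : nat} {M : manifold R n}.
Variable E : vbundle M r.

Definition pt (m : M) (v : fib E m) : tot E := existT (fib E) m v.
Definition qE (p : tot E) : M := projT1 p.
Definition vec (p : tot E) : fib E (qE p) := projT2 p.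

Lemma qE_smooth : smooth_map qE.
Proof. exact: vb_proj_smooth. Qed.

Definition vline (m : M) (v w : fib E m) (t : R) : tot E := pt (v + t *: w).

Lemma vline0 m (v w : fib E m) : vline v w 0 = pt v.
Proof. by rewrite /vline scale0r addr0. Qed.

Lemma vline_derivable m (v w : fib E m) (f : Cinf (tot E)) :
  derivable (fun t => f (vline v w t)) 0 1.
Proof.
have [t [ot tm tK ct]] := vb_trivial E m.
have [c ac cm] := atlas_cover (mfd_struct M) m.
have [hc cc] := ct c ac.
have sf := smooth_fun_chart (CinfP f) hc cc.
have [oD oI cK _ _] := hc.
pose g (s : R) : 'rV[R]_(n + r) :=
  cst (row_mx (cfun c m) (tfun t m v)) s + s *: row_mx 0 (tfun t m w).
have gE s : cfun (triv_chart c t) (vline v w s) = g s.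
  by rewrite /g /= linearD linearZ/= scale_row_mx scaler0 add_row_mx addr0.
have Dv s : cdom (triv_chart c t) (vline v w s) by [].
have fE s : f (vline v w s) = (f \o cinv (triv_chart c t) \o g) s.
  by rewrite -[RHS]/(f (cinv (triv_chart c t) (g s))) -gE (cK _ (Dv s)).
have dg : differentiable g (0 : R).
  by apply: differentiableD => //; apply: differentiableZl.
apply/derivable1_diffP; rewrite (_ : (fun _ => _) = f \o cinv (triv_chart c t) \o g).
  apply: differentiable_comp => //.
  by have [df _] := sf 1%N; apply: df; rewrite -gE; exists (vline v w 0).
exact/funext.
Qed.

Lemma vlift_derivation (p : tot E) (w : fib E (qE p)) :
  is_derivation p (fun f => derive1 (fun t => f (vline (vec p) w t)) 0).
Proof.
have p0 : vline (vec p) w 0 = p by rewrite vline0; case: p w.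
have dl f := @vline_derivable _ (vec p) w f.
split=> [a f g|f g]; first exact: (derive1_lin a (dl f) (dl g)).
have -> : g p = g (vline (vec p) w 0) by rewrite p0.
have -> : f p = f (vline (vec p) w 0) by rewrite p0.
exact: (derive1_mul (dl f) (dl g)).
Qed.

(* The vector of T_p E with velocity d/dt|_0 (p + t w). *)
Definition vlift (p : tot E) (w : fib E (qE p)) : tangent p :=
  mkTangent (vlift_derivation w).

End bundle_geometry.

Section sections.
Context {R : realType} {n r : nat} {M : manifold R n}.
Variable E : vbundle M r.

Record sec := Sec {
  sec_fun :> forall m : M, fib E m;
  sec_smooth : smooth_map (fun m : M => pt (sec_fun m)) }.

(* A family of covectors eps_m in E_m^* is smooth when the fibrewise linear
   function l_eps on the total space of E is. *)
Record dsec := DSec {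
  dsec_fun :> forall m : M, dual (fib E m);
  dsec_smooth : smooth_fun (fun p : tot E => dsec_fun (qE p) (vec p)) }.

Definition ell (eps : dsec) : Cinf (tot E) := mkCinf (dsec_smooth eps).

Lemma dsecD_smooth (eps1 eps2 : dsec) :
  smooth_fun (fun p : tot E => (eps1 (qE p) + eps2 (qE p)) (vec p)).
Proof. exact: (CinfP (ell eps1 + ell eps2)). Qed.
Definition dsecD (eps1 eps2 : dsec) : dsec :=
  @DSec (fun m => eps1 m + eps2 m) (dsecD_smooth eps1 eps2).

Lemma dsecZ_smooth (f : Cinf M) (eps : dsec) :
  smooth_fun (fun p : tot E => (f (qE p) *: eps (qE p)) (vec p)).
Proof. exact: (CinfP (comp_Cinf (qE_smooth E) f * ell eps)). Qed.
Definition dsecZ (f : Cinf M) (eps : dsec) : dsec :=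
  @DSec (fun m => f m *: eps m) (dsecZ_smooth f eps).

(* A section of a direct sum is a pair of sections: Gamma(TM (+) E^* ) and Gamma(E (+) T^*M). *)
Definition gamma : Type := vfield M * dsec.
Definition cogamma : Type := sec * form1 M.

Definition gammaD (nu1 nu2 : gamma) : gamma :=
  (vfD nu1.1 nu2.1, dsecD nu1.2 nu2.2).
Definition gammaZ (f : Cinf M) (nu : gamma) : gamma :=
  (vfZ f nu.1, dsecZ f nu.2).
Definition gammaZr (a : R) (nu : gamma) : gamma :=
  gammaZ (a *: (1 : Cinf M)) nu.

Definition pairing (nu : gamma) (tau : cogamma) : Cinf M :=
  comp_Cinf (sec_smooth tau.1) (ell nu.2) + form1_app tau.2 nu.1.

Record dorfman := Dorfman {
  dbr :> gamma -> gamma -> gamma;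
  dbr_linl : forall (a : R) nu1 nu2 nu3,
    dbr (gammaD (gammaZr a nu1) nu2) nu3 =
    gammaD (gammaZr a (dbr nu1 nu3)) (dbr nu2 nu3);
  dbr_linr : forall (a : R) nu1 nu2 nu3,
    dbr nu1 (gammaD (gammaZr a nu2) nu3) =
    gammaD (gammaZr a (dbr nu1 nu2)) (dbr nu1 nu3);
  dbr_anchor : forall nu1 nu2, (dbr nu1 nu2).1 = lie nu1.1 nu2.1;
  dbr_leibniz : forall nu1 nu2 f,
    dbr nu1 (gammaZ f nu2) =
    gammaD (gammaZ f (dbr nu1 nu2)) (gammaZ (vf_act nu1.1 f) nu2);
  dbr_jacobi : forall nu1 nu2 nu3,
    dbr nu1 (dbr nu2 nu3) =
    gammaD (dbr (dbr nu1 nu2) nu3) (dbr nu2 (dbr nu1 nu3)) }.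

(* D nu is the derivation D_nu of Gamma(E (+) T^*M); since the pairing is
   nondegenerate, this identity determines it. *)
Definition is_dual_derivation (br : dorfman)
    (D : gamma -> cogamma -> cogamma) :=
  forall nu nu' tau, vf_act nu.1 (pairing nu' tau) =
    pairing nu' (D nu tau) + pairing (br nu nu') tau.

(* (w, th)^up at the point p of E. *)
Definition up (p : tot E) (w : fib E (qE p)) (th : cotangent (qE p)) :
    tangent p * cotangent p :=
  (vlift w, pull (qE_smooth E) th).

(* T_m e x + w^up, the vectors of T_(e m) E over x in T_m M. *)
Definition tvec (e : sec) (m : M) (x : tangent m) (w : fib E m) :
    tangent (pt (e m)) :=
  push (sec_smooth e) x + @vlift _ _ _ _ _ (pt (e m)) w.

(* The vector bundle TE (+) T^*E -> TM (+) E^* has projection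
   (U, al) |-> (Tq U, w |-> al(w^up)). Its linear structure is, on TE -> TM,
     a.(T e1 x + w1^up) + (T e2 x + w2^up) = T (a e1 + e2) x + (a w1 + w2)^up,
   and, on T^*E -> E^*, the one that makes the pairing of T^*E with TE linear. *)
Record linear_section := LinearSection {
  ls_vf : vfield (tot E);
  ls_form : form1 (tot E);
  ls_over : exists nu : gamma, forall p : tot E,
    push (qE_smooth E) (ls_vf p) = nu.1 (qE p) /\
    forall w : fib E (qE p), ls_form p (vlift w) = nu.2 (qE p) w;
  ls_vf_linear : forall (a : R) (e1 e2 e3 : sec),
    (forall m, e3 m = a *: e1 m + e2 m) ->
    forall m (x : tangent m) w1 w2,
      ls_vf (pt (e1 m)) = tvec e1 x w1 -> ls_vf (pt (e2 m)) = tvec e2 x w2 ->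
      ls_vf (pt (e3 m)) = tvec e3 x (a *: w1 + w2);
  ls_form_linear : forall (a : R) (e1 e2 e3 : sec),
    (forall m, e3 m = a *: e1 m + e2 m) ->
    forall m (x : tangent m) w1 w2,
      ls_form (pt (e3 m)) (tvec e3 x (a *: w1 + w2)) =
      a * ls_form (pt (e1 m)) (tvec e1 x w1) +
      ls_form (pt (e2 m)) (tvec e2 x w2) }.

Definition ls_val (chi : linear_section) (p : tot E) :
    tangent p * cotangent p :=
  (ls_vf chi p, ls_form chi p).

Coercion ls_val : linear_section >-> Funclass.

Definition is_lift (br : dorfman) (Xi : gamma -> linear_section) :=
  exists2 D, is_dual_derivation br D &
  forall (nu : gamma) (e : sec) (m : M),
    let tau := D nu (e, form1_0 M) in
    Xi nu (pt (e m)) =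
    (push (sec_smooth e) (nu.1 m), diff_at (pt (e m)) (ell nu.2))
    - @up (pt (e m)) (tau.1 m) (tau.2 m).

Definition Phi_form2 (B : form2 (tot E)) (p : tot E)
    (u : tangent p * cotangent p) : tangent p * cotangent p :=
  (u.1, u.2 + B p u.1).

(* Omega^1(M, E^* ). *)
Record eform := EForm {
  eform_fun :> forall m : M, {linear tangent m -> dual (fib E m)};
  eform_smooth : forall X : vfield M,
    smooth_fun (fun p : tot E => eform_fun (qE p) (X (qE p)) (vec p)) }.

Definition contract (beta : eform) (X : vfield M) : dsec :=
  @DSec (fun m => beta m (X m)) (eform_smooth beta X).

Definition Phi_eform (beta : eform) (nu : gamma) : gamma :=
  (nu.1, dsecD nu.2 (contract beta nu.1)).

Lemma eform_at_scalar (beta : eform) (m : M) (w : fib E m) :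
  scalar (fun x : tangent m => beta m x w).
Proof. by move=> a x y; rewrite linearP. Qed.

(* <beta, e>(m) for any section e with e(m) = w. *)
Definition eform_at (beta : eform) (m : M) (w : fib E m) : cotangent m :=
  mkDual (eform_at_scalar beta w).

Definition Lambda (beta : eform) (p : tot E) : cotangent p :=
  pull (qE_smooth E) (eform_at beta (vec p)).

End sections.

(* Main.v *)
(* Write D_nu (e, 0) = (D1, D2). At the point e(m) the lift intertwines the B-field
   transformation with Phi_beta iff D1 is the same for nu and Phi_beta nu, and
     (D2 for Phi_beta nu) - (D2 for nu) = (L_Y Lambda_beta)(Z)
   on the image in T_m M of every vector field Z on E, where Y is the vector field
   part of Xi nu; this uses Lambda_beta(Y) = l_(i_X beta) and Cartan's formula.
   Dualizing the bracket, beta is a symmetry iff the same two identities hold with Z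
   the vector field part of the lift of an arbitrary nu', which gives one direction.
   For the other, (L_Y Lambda_beta)(Z) depends only on the image of Z on M, because
   Lambda_beta is locally a combination of pulled back differentials and Y is
   projectable.

   Tangent vectors are derivations of the algebra of smooth functions, so that
   extending them to vector fields rests on Hadamard's lemma
   f(y) = f(p) + sum_i (y_i - p_i) h_i(y) and on bump functions. *)

From HB Require Import structures.
From mathcomp Require Import interval_inference landau sequences realfun exp constructive_ereal.
From mathcomp Require Import measure lebesgue_measure lebesgue_integral ftc ring lra.
Require Import Defs.
From mathcomp Require Import all_boot all_order all_algebra.
From mathcomp Require Import boolp classical_sets functions reals topology.
From mathcomp Require Import normedtype derive.

Set Implicit Arguments.
Unset Strict Implicit.
Unset Printing Implicit Defensive.

Import Order.TTheory GRing.Theory Num.Theory.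
Import numFieldNormedType.Exports.

Local Open Scope classical_set_scope.
Local Open Scope ring_scope.

(** * Smooth functions and steps *)

Section calculus.
Context {R : realType}.

Lemma derive_comp_scalar {V : normedModType R} (h : R -> R) (g : V -> R) x v :
  derivable h (g x) 1 -> differentiable g x ->
  differentiable (h \o g) x /\ 'D_v (h \o g) x = 'D_v g x * 'D_1 h (g x).
Proof.
move=> /derivable1_diffP dh dg.
have dhg : differentiable (h \o g) x by exact: differentiable_comp.
split=> //.
rewrite deriveE// diff_comp//= -(deriveE v dg).
by rewrite diff1E// derive1E.
Qed.

Lemma Ck_inv {V : normedModType R} k (U : set V) (g : V -> R) :
  open U -> (forall x, U x -> g x != 0) -> Ck k U g ->
  Ck k U (fun x => (g x)^-1).
Proof.
move=> oU g0; elim: k => [|k IH] Cg.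
  by move=> x Ux; apply: cvgV; [exact: g0|exact: Cg].
have [dg Dg] := Cg; split=> [x Ux|v].
  by apply: differentiableV; [exact: dg|exact: g0].
have Ci := IH (CkW Cg).
apply: (@Ck_ext _ _ _ _ _ _ ((-1) \*: ((fun x => (g x)^-1) \*
  ((fun x => (g x)^-1) \* 'D_v g)))) => //.
  move=> x Ux; rewrite deriveV; [|exact: g0|exact/diff_derivable/dg].
  by rewrite /= /GRing.scale/= expr2 invfM; ring.
by apply: CkZ => //; do 2 apply: CkM => //; exact: Dg.
Qed.

(** The powers of $1/t$ make this family closed under differentiation up to linear combinations, so
    smoothness of the classical case [j = 0] follows by an induction on the order, for all [j] at
    once. *)
Definition flat (j : nat) (t : R) : R :=
  if 0 < t then t^-1 ^+ j * expR (- t^-1) else 0.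

Lemma flat_ge0 j t : 0 <= flat j t.
Proof.
rewrite /flat; case: ifP => // t0.
by rewrite mulr_ge0 ?expR_ge0// exprn_ge0// invr_ge0 ltW.
Qed.

Lemma flat_gt0 j t : 0 < t -> 0 < flat j t.
Proof. by move=> t0; rewrite /flat t0 mulr_gt0 ?expR_gt0// exprn_gt0// invr_gt0. Qed.

Lemma flat_le0 j t : t <= 0 -> flat j t = 0.
Proof. by rewrite /flat; case: ltP. Qed.

(** With $u = 1/t$, the exponential series gives $u^{j+2} \le (j+2)!\,e^u$, and $u^j = t^2u^{j+2}$.
    A quadratic bound is what makes the derivative at 0 vanish. *)
Lemma flat_le_sqr j t : flat j t <= j.+2`!%:R * t ^+ 2.
Proof.
rewrite /flat; case: ifP => t0; last by rewrite mulr_ge0 ?sqr_ge0.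
have u0 : 0 < t^-1 by rewrite invr_gt0.
have := expR_ge1Dxn j.+1 (ltW u0); set c := (X in X`!) => H.
have {}H : t^-1 ^+ j.+2 <= c`!%:R * expR t^-1.
  rewrite mulrC -ler_pdivrMr ?ltr0n ?fact_gt0//.
  by apply: le_trans H; rewrite lerDr.
rewrite expRN -[leRHS](mulfK (lt0r_neq0 (expR_gt0 t^-1))).
rewrite ler_pM2r ?invr_gt0 ?expR_gt0//.
have -> : t^-1 ^+ j = t ^+ 2 * t^-1 ^+ j.+2.
  rewrite (exprD _ 2 j) mulrA -exprMn mulfV ?expr1n ?mul1r//; exact: lt0r_neq0.
by rewrite [_ * t ^+ 2]mulrC -[leRHS]mulrA ler_pM2l ?exprn_gt0.
Qed.

Lemma is_derive0_sqr_bound (f : R -> R) c :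
  (forall t, `|f t| <= c * t ^+ 2) -> is_derive (0 : R) (1 : R) f 0.
Proof.
move=> fc; have f0 : f 0 = 0.
  by apply/eqP; rewrite -normr_le0 (le_trans (fc 0))// expr0n mulr0.
suff q0 : (fun h => h^-1 *: (f (h *: 1 + 0) - f 0)) @ 0^' --> 0.
  by apply: DeriveDef; [apply/cvg_ex; exists 0|exact: cvg_lim].
apply: norm_cvg0.
apply: (@squeeze_cvgr _ _ _ _ (cst 0) (fun h => c * `|h|)).
- near=> h; rewrite normr_ge0/= f0 subr0 addr0.
  have h0 : h != 0 by near: h; exact: nbhs_dnbhs_neq.
  rewrite normrM normfV -ler_pdivlMl ?invr_gt0 ?normr_gt0// invrK.
  rewrite -[X in f X]/(h * 1) mulr1 (le_trans (fc h))//.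
  by rewrite -(@real_normK _ h) ?num_real// expr2 mulrCA.
- exact: cvg_cst.
- have : c * `|h| @[h --> (0 : R)] --> c * `|0 : R|.
    by apply: cvgMr; exact: cvg_norm.
  by rewrite normr0 mulr0; exact: cvg_within_filter.
Unshelve. all: by end_near. Qed.

Lemma is_derive_flat j (t : R) :
  is_derive t 1 (flat j) (- j%:R * flat j.+1 t + flat j.+2 t).
Proof.
have [t0|t0|->] := ltgtP t 0.
- rewrite !(@flat_le0 _ t) ?ltW// mulr0 addr0.
  apply: (near_eq_is_derive (f := cst 0)).
    near=> s; rewrite flat_le0//; apply/ltW; near: s.
    exact: lt_nbhsl.
- apply: (near_eq_is_derive (f := (fun s => s^-1) ^+ j * (expR \o (- (fun s => s^-1))))).
    near=> s; have s0 : 0 < s by near: s; exact: lt_nbhsr.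
    by rewrite /flat s0 !fctE.
  have tn0 : t != 0 by exact: lt0r_neq0.
  have dV : is_derive t 1 (fun s : R => s^-1) (- t ^- 2).
    have := @derivableV _ _ (@id R) t 1 tn0 (@derivable_id _ _ _ _).
    move=> h; apply: DeriveDef => //.
    by rewrite (@deriveV _ _ (@id R) t 1 tn0 (@derivable_id _ _ _ _)) derive_id scaler1.
  have dE : is_derive t 1 (expR \o (- (fun s : R => s^-1)))
      (expR (- t^-1) * - - t ^- 2).
    by apply: is_derive1_comp.
  apply: is_derive_eq.
  rewrite /flat t0 !fctE /= /GRing.scale/= opprK -!exprVn.
  by case: j => [|j] /=; rewrite ?exprS; ring.
- rewrite !(@flat_le0 _ 0)// mulr0 addr0.
  apply: (@is_derive0_sqr_bound _ j.+2`!%:R) => s.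
  by rewrite ger0_norm ?flat_ge0// flat_le_sqr.
Unshelve. all: by end_near. Qed.

Lemma Ck_flat {V : normedModType R} k j (U : set V) (g : V -> R) :
  open U -> Ck k U g -> Ck k U (flat j \o g).
Proof.
move=> oU; elim: k j => [|k IH] j Cg.
  move=> x Ux; apply: (continuous_comp (Cg x Ux)).
  have [d _] := is_derive_flat j (g x).
  exact/differentiable_continuous/derivable1_diffP.
have [dg Dg] := Cg.
have dc x v : U x -> differentiable (flat j \o g) x /\ 'D_v (flat j \o g) x =
    'D_v g x * (- j%:R * flat j.+1 (g x) + flat j.+2 (g x)).
  move=> Ux; have [d <-] := is_derive_flat j (g x).
  by apply: derive_comp_scalar => //; exact: dg.
split=> [x Ux|v]; first by have [] := dc x 0 Ux.
apply: (@Ck_ext _ _ _ _ _ _ ('D_v g \*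
  (((- j%:R) \*: (flat j.+1 \o g)) \+ (flat j.+2 \o g)))) => //.
  by move=> x Ux; have [_ ->] := dc x v Ux.
apply: CkM => //; first exact: Dg.
apply: CkD => //; last exact/IH/CkW.
by apply: CkZ => //; exact/IH/CkW.
Qed.

Definition smooth_step (t : R) : R := flat 0 t / (flat 0 t + flat 0 (1 - t)).

(** At least one of $t$ and $1-t$ is positive. *)
Lemma smooth_step_denom t : 0 < flat 0 t + flat 0 (1 - t).
Proof.
have [t0|t0] := ltP 0 t; first by rewrite ltr_wpDr ?flat_ge0 ?flat_gt0.
by rewrite ltr_wpDl ?flat_ge0// flat_gt0//; lra.
Qed.

Lemma smooth_step0 t : t <= 0 -> smooth_step t = 0.
Proof. by move=> t0; rewrite /smooth_step flat_le0// mul0r. Qed.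

Lemma smooth_step1 t : 1 <= t -> smooth_step t = 1.
Proof.
move=> t1; have := smooth_step_denom t; rewrite /smooth_step.
by rewrite (@flat_le0 _ (1 - t)) ?subr_le0// addr0 => /lt0r_neq0/divff.
Qed.

Lemma Ck_smooth_step {V : normedModType R} k (U : set V) (g : V -> R) :
  open U -> Ck k U g -> Ck k U (smooth_step \o g).
Proof.
move=> oU Cg; apply: CkM => //; first exact: Ck_flat.
apply: Ck_inv => // [x _|]; first exact/lt0r_neq0/smooth_step_denom.
apply: CkD => //; first exact: Ck_flat.
apply: (@Ck_flat _ _ _ _ (fun x => 1 - g x)) => //.
apply: (@Ck_ext _ _ _ _ _ _ ((cst 1) \+ ((-1) \*: g))) => //.
  by move=> x _ /=; rewrite scaleN1r.
by apply: CkD => //; [exact: Ck_cst|exact: CkZ].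
Qed.

End calculus.

(** * Integration over the unit interval *)

Section hadamard.
Context {R : realType}.
Notation mu := (@lebesgue_measure R).

Definition integral01 (f : R -> R) : R := (\int[mu]_(t in `[0%R, 1%R]) f t)%R.

Lemma integrable01 (f : R -> R) : continuous f ->
  mu.-integrable `[0%R, 1%R] (EFin \o f).
Proof.
move=> cf; apply: continuous_compact_integrable; first exact: segment_compact.
exact: continuous_subspaceT.
Qed.

Lemma integral01D (f g : R -> R) : continuous f -> continuous g ->
  integral01 (fun t => f t + g t) = integral01 f + integral01 g.
Proof. by move=> cf cg; apply: RintegralD => //; exact: integrable01. Qed.

Lemma integral01Z a (f : R -> R) : continuous f ->
  integral01 (fun t => a * f t) = a * integral01 f.
Proof. by move=> cf; apply: RintegralZl => //; exact: integrable01. Qed.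

Lemma continuous_sum m (f : 'I_m -> R -> R) : (forall i, continuous (f i)) ->
  continuous (fun t => \sum_(i < m) f i t).
Proof.
elim: m f => [|m IH] f cf.
  rewrite (_ : (fun _ => _) = cst 0); first exact: cst_continuous.
  by apply/funext => t; rewrite big_ord0.
rewrite (_ : (fun _ => _) =
    fun t => f ord0 t + \sum_(i < m) f (lift ord0 i) t); last first.
  by apply/funext => t; rewrite big_ord_recl.
by move=> t; apply: cvgD; [exact: cf|apply: IH].
Qed.

Lemma integral01_sum m (f : 'I_m -> R -> R) : (forall i, continuous (f i)) ->
  integral01 (fun t => \sum_(i < m) f i t) = \sum_(i < m) integral01 (f i).
Proof.
elim: m f => [|m IH] f cf.
  rewrite big_ord0; transitivity (0 * integral01 (cst 0)); last by rewrite mul0r.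
  rewrite -integral01Z; last exact: cst_continuous.
  by congr integral01; apply/funext => t; rewrite big_ord0 mul0r.
rewrite big_ord_recl -IH// -integral01D//; last exact: continuous_sum.
by congr integral01; apply/funext => t; rewrite big_ord_recl.
Qed.

Lemma integral01_cst (c : R) : integral01 (cst c) = c.
Proof.
have mu01 : mu `[0%R, 1%R] = 1%E.
  have := @lebesgue_measure_itv R `[0%R, 1%R].
  by rewrite /= lte_fin ltr01 oppr0 adde0.
transitivity (c * fine (mu `[0%R, 1%R])); last by rewrite mu01 mulr1.
exact: Rintegral_cst.
Qed.

Lemma integral01_le (f : R -> R) c : continuous f ->
  (forall t, 0 <= t <= 1 -> `|f t| <= c) -> `|integral01 f| <= c.
Proof.
move=> cf fc; rewrite -[c]integral01_cst.
apply: (le_trans (le_normr_Rintegral _ _)) => //; first exact: integrable01.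
apply: le_Rintegral => //.
  by apply: integrable01 => t; apply: cvg_norm; exact: cf.
by apply: integrable01; exact: cst_continuous.
Qed.

Lemma integral01_derive (f df : R -> R) : continuous df ->
  (forall t : R, is_derive t 1 f (df t)) -> integral01 df = f 1 - f 0.
Proof.
move=> cdf hf.
have cf : continuous f.
  move=> t; have [d _] := hf t.
  exact/differentiable_continuous/derivable1_diffP.
have -> : f 1 - f 0 = fine ((f 1)%:E - (f 0)%:E)%E by [].
rewrite /integral01 /Rintegral; congr fine.
apply: continuous_FTC2 => //.
- exact: continuous_subspaceT.
- split=> [t _||]; first by have [] := hf t.
  + exact/cvg_at_right_filter/cf.
  + exact/cvg_at_left_filter/cf.
- by move=> t _; rewrite derive1E; have [_ ->] := hf t.
Qed.

Lemma continuous_near0 {V : normedModType R} (f : V -> R) (y : V) :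
  (forall e, 0 < e -> \forall h \near (0 : V), `|f (y + h) - f y| <= e) ->
  {for y, continuous f}.
Proof.
move=> H; apply/cvgrPdist_le => e e0; apply/nbhs0P.
by apply: filterS (H e e0) => h; rewrite distrC.
Qed.

(** In the covering form of compactness, it suffices to have the bound for pairs close to $(x,0)$,
    for each single $x\in K$; there both $F(x+h)$ and $F(x)$ are continuous in the pair. *)
Lemma compact_unif_continuous {V : normedModType R} (F : V -> R) (K : set V) :
  compact K -> continuous F -> forall e, 0 < e ->
  \forall h \near (0 : V), forall x, K x -> `|F (x + h) - F x| <= e.
Proof.
move=> cK cF e e0.
have /compact_near_coveringP := cK.
move=> /(_ V (nbhs (0 : V)) (fun h x => `|F (x + h) - F x| <= e) _).
apply=> x Kx.
have c1 : {for (x, 0), continuous (fun z : V * V => F (z.1 + z.2))}.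
  apply: (@continuous_comp _ _ _ (fun z : V * V => z.1 + z.2) F); last exact: cF.
  by apply: cvgD; [exact: cvg_fst|exact: cvg_snd].
have c2 : {for (x, 0), continuous (fun z : V * V => F z.1)}.
  apply: (@continuous_comp _ _ _ (fun z : V * V => z.1) F); last exact: cF.
  exact: cvg_fst.
have := cvgB c1 c2; rewrite /= addr0 subrr => /(_ _)/cvgrPdist_le => c3.
have := c3 e e0; apply: filterS => z /=.
by rewrite distrC subr0.
Qed.

(** The hypothesis is the little-o estimate for the linear form with coefficients [a]; this form is
    continuous, so by uniqueness it is the differential. *)
Lemma differentiable_rV n (f : 'rV[R]_n -> R) y (a : 'I_n -> R) :
  (forall e, 0 < e -> \forall h \near (0 : 'rV[R]_n),
     `|f (y + h) - f y - \sum_(i < n) h ord0 i * a i| <= e * `|h|) ->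
  differentiable f y /\
  forall v, 'D_v f y = \sum_(i < n) v ord0 i * a i.
Proof.
move=> fa.
pose A (h : 'rV[R]_n) : R^o := \sum_(i < n) h ord0 i * a i.
have A_lin : linear A.
  move=> b u w; rewrite /A scaler_sumr -big_split/=; apply: eq_bigr => i _.
  by rewrite !mxE mulrDl -mulrA.
pose Ai := GRing.isLinear.Build _ _ _ _ _ A_lin.
pose AL : {linear 'rV[R]_n -> R^o} := HB.pack A Ai.
have cA : continuous (AL : 'rV[R]_n -> R).
  suff C0 : Ck 0 setT (fun h : 'rV[R]_n => \sum_(i < n) h ord0 i * a i).
    by move=> x; exact: C0.
  apply: (@Ck_sum R 'rV[R]_n R 0 setT n (fun i h => h ord0 i * a i)) => [|i].
    exact: openT.
  apply: (CkM (f := fun h : 'rV[R]_n => h ord0 i) openT); last exact: Ck_cst.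
  by move=> x _; exact: coord_continuous.
pose g : 'rV[R]_n -> R^o := f.
have E : g \o shift y = cst (g y) + AL +o_ (0 : 'rV[R]_n) id.
  apply/eqaddoP => e e0; near=> h.
  rewrite -[leLHS]/(`|f (h + y) - (f y + \sum_(i < n) h ord0 i * a i)|) opprD addrA.
  rewrite [h + y]addrC.
  by near: h; exact: fa.
have dE := diff_unique cA E.
have df : differentiable g y by apply/diff_locallyP; rewrite dE.
by split=> // v; rewrite -[LHS]/('D_v g y) deriveE// dE.
Unshelve. all: by end_near. Qed.

Lemma derive_rV n (f : 'rV[R]_n -> R) y v : differentiable f y ->
  'D_v f y = \sum_(i < n) v ord0 i * 'D_(delta_mx ord0 i) f y.
Proof.
move=> df; rewrite deriveE// {1}(row_sum_delta v) linear_sum.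
by apply: eq_bigr => i _; rewrite linearZ/= -deriveE.
Qed.

Lemma rV_coord_le_norm n (h : 'rV[R]_n) i : `|h ord0 i| <= `|h|.
Proof.
rewrite [leRHS]/Num.Def.normr/= mx_normrE.
by apply/bigmax_geP; right => /=; exists (ord0, i).
Qed.

(** * Weighted means along segments *)

Section radial.
Context {n : nat}.
Implicit Types (F : 'rV[R]_n -> R) (p y h : 'rV[R]_n).

Lemma radial_continuous p y : continuous (fun t : R => p + t *: (y - p)).
Proof.
move=> t; apply: cvgD; first exact: cvg_cst.
by apply: cvgZr_tmp; exact: cvg_id.
Qed.

Lemma radialD p y h (t : R) :
  p + t *: (y + h - p) = p + t *: (y - p) + t *: h.
Proof. by rewrite addrAC scalerDr addrA. Qed.

(** The segment from [p] to [y] is compact. The factor [s] covers the intermediate points that the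
    mean value theorem will produce. *)
Lemma radial_unif_continuous F p y e : continuous F -> 0 < e ->
  \forall h \near (0 : 'rV[R]_n), forall t s : R, 0 <= t <= 1 -> 0 <= s <= 1 ->
    `|F (p + t *: (y - p) + s *: h) - F (p + t *: (y - p))| <= e.
Proof.
move=> cF e0.
have cK : compact [set p + t *: (y - p) | t in `[0 : R, 1]].
  apply: continuous_compact; last exact: segment_compact.
  exact/continuous_subspaceT/radial_continuous.
have /nbhs_normP[d /= d0 dF] := compact_unif_continuous cK cF e0.
apply/nbhs_normP; exists d => //= h; rewrite /ball_/= sub0r normrN => hd.
move=> t s t01 /andP[s0 s1]; apply: dF; last by exists t; rewrite //= in_itv.
rewrite /ball_/= sub0r normrN normrZ ger0_norm//.
by rewrite (le_lt_trans _ hd)// ler_piMl.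
Qed.

(** For [j = 0] and a partial derivative [F], this is a coefficient in Hadamard's lemma. Each
    differentiation in [y] under the integral sign brings out one more factor $t$, whence the
    weight. *)
Definition radial_mean j F p y : R :=
  integral01 (fun t => t ^+ j * F (p + t *: (y - p))).

Lemma radial_integrand_continuous j F p y : continuous F ->
  continuous (fun t : R => t ^+ j * F (p + t *: (y - p))).
Proof.
move=> cF t; apply: cvgM; first exact: exprn_continuous.
apply: (@continuous_comp _ _ _ (fun t : R => p + t *: (y - p)) F).
  exact: radial_continuous.
exact: cF.
Qed.

Lemma radial_mean_continuous j F p : continuous F -> continuous (radial_mean j F p).
Proof.
move=> cF y.
apply: (@continuous_near0 'rV[R]_n) => e e0.
have U := radial_unif_continuous p y cF e0.
apply: filterS U => h U.
have ci y' := @radial_integrand_continuous j F p y' cF.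
rewrite /radial_mean -[X in _ - X]mul1r -mulNr -integral01Z// -integral01D//; last first.
  by move=> t; apply: cvgM; [exact: cvg_cst|exact: ci].
apply: integral01_le => [t|t t01].
  apply: cvgD; first exact: ci.
  by apply: cvgM; [exact: cvg_cst|exact: ci].
rewrite radialD.
rewrite mulN1r -mulrBr normrM.
have /andP[t0 t1] := t01.
rewrite ger0_norm ?exprn_ge0// -[leRHS]mul1r ler_pM ?exprn_ge0 ?exprn_ile1//.
exact: U.
Qed.

End radial.

End hadamard.

(** * Hadamard's lemma *)

Section hadamard_lemma.
Context {R : realType}.

Lemma is_derive_along {V : normedModType R} (F : V -> R) (z w : V) (s : R) :
  derivable F (z + s *: w) w ->
  is_derive s 1 (fun t => F (z + t *: w)) ('D_w F (z + s *: w)).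
Proof.
move=> dF; set g := fun t => F _.
have E : (fun h : R => h^-1 *: ((g \o shift s) (h *: 1) - g s)) =
    (fun h : R => h^-1 *: ((F \o shift (z + s *: w)) (h *: w) - F (z + s *: w))).
  apply/funext => h; rewrite /= /g; do 3 congr (_ _).
  by rewrite -[h *: 1]/(h * 1) mulr1 scalerDl addrCA.
by apply: DeriveDef; rewrite /derivable /derive E.
Qed.

Context {n : nat}.
Implicit Types (F : 'rV[R]_n -> R) (p y h : 'rV[R]_n).
Notation partial i F := ('D_(delta_mx ord0 i) F).

(** By the mean value theorem along $z+sh$, the increment is $t\sum_i h_i\,\partial_iF(z+ch)$ with
    $0\le c\le t$, and each partial derivative differs from its value at $z$ by at most $e$. *)
Lemma increment_bound F z h (t e : R) : 0 <= t <= 1 ->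
  (forall x, differentiable F x) ->
  (forall i s, 0 <= s <= 1 ->
     `|partial i F (z + s *: h) - partial i F z| <= e) ->
  `|F (z + t *: h) - F z - t * \sum_(i < n) h ord0 i * partial i F z| <=
    (\sum_(i < n) e) * `|h|.
Proof.
move=> /andP[t0 t1] dF dFe.
have dg (s : R) := is_derive_along (@diff_derivable _ _ _ F _ h (dF (z + s *: h))).
have [|c] := @MVT_segment _ _ _ 0 t t0 (fun s _ => dg s).
  apply: continuous_subspaceT => s.
  have [d _] := dg s; exact/differentiable_continuous/derivable1_diffP.
rewrite in_itv/= => /andP[c0 ct]; rewrite scale0r addr0 subr0 => ->.
rewrite derive_rV// [_ * t]mulrC -mulrBr -sumrB normrM ger0_norm//.
apply: (@le_trans _ _ (\sum_(i < n) e * `|h|)); last by rewrite mulr_suml.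
apply: le_trans (ler_piMl _ t1) _ => //.
apply: le_trans (ler_norm_sum _ _ _) _; apply: ler_sum => i _.
rewrite -mulrBr normrM mulrC ler_pM// ?rV_coord_le_norm//.
by apply: dFe; rewrite c0 (le_trans ct).
Qed.

(** Differentiation under the integral sign: [increment_bound] controls the first-order remainder of
    the integrand uniformly in $t\in[0,1]$. *)
Lemma radial_mean_diff j F p y : Ck 1 setT F ->
  differentiable (radial_mean j F p) y /\
  forall v, 'D_v (radial_mean j F p) y =
    \sum_(i < n) v ord0 i * radial_mean j.+1 (partial i F) p y.
Proof.
move=> CF; have [dF cdF] := CF.
have cF : continuous F by move=> x; exact/differentiable_continuous/dF.
have cD i : continuous (partial i F) by move=> x; exact: cdF.
apply: differentiable_rV => e e0.
(* The bounds for the [n] partial derivatives add up to at most [e]; dividing by [n.+1] also covers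
   [n = 0]. *)
pose e' := e / n.+1%:R.
have e'0 : 0 < e' by rewrite divr_gt0.
have U : \forall h \near (0 : 'rV[R]_n), forall i (t s : R), 0 <= t <= 1 -> 0 <= s <= 1 ->
    `|partial i F (p + t *: (y - p) + s *: h) - partial i F (p + t *: (y - p))| <= e'.
  apply: (@filter_forall _ 'I_n (fun i (h : 'rV[R]_n) => forall t s : R, 0 <= t <= 1 ->
    0 <= s <= 1 -> `|partial i F (p + t *: (y - p) + s *: h) -
                    partial i F (p + t *: (y - p))| <= e')
    (nbhs (0 : 'rV[R]_n)) (nbhs_filter (0 : 'rV[R]_n))) => i.
  exact: (radial_unif_continuous p y (cD i) e'0).
apply: filterS U => h U.
have ci j' y' := @radial_integrand_continuous R n j' F p y' cF.
have cDi j' i y' := @radial_integrand_continuous R n j' (partial i F) p y' (cD i).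
have cs : continuous (fun t : R => \sum_(i < n) h ord0 i *
    (t ^+ j.+1 * partial i F (p + t *: (y - p)))).
  by apply: continuous_sum => i t; apply: cvgM; [exact: cvg_cst|exact: cDi].
(* The remainder of the mean is the mean of the remainders, so a pointwise bound on one integrand
   suffices. *)
have -> : radial_mean j F p (y + h) - radial_mean j F p y -
    \sum_(i < n) h ord0 i * radial_mean j.+1 (partial i F) p y =
  integral01 (fun t => t ^+ j * F (p + t *: (y + h - p)) +
   (-1) * (t ^+ j * F (p + t *: (y - p)) +
    \sum_(i < n) h ord0 i * (t ^+ j.+1 * partial i F (p + t *: (y - p))))).
  rewrite integral01D; [|exact: ci|].
    rewrite integral01Z; last by move=> t; apply: cvgD; [exact: ci|exact: cs].
    rewrite (integral01D (ci _ _) cs).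
    rewrite integral01_sum; last first.
      by move=> i t; apply: cvgM; [exact: cvg_cst|exact: cDi].
    rewrite mulN1r opprD addrA; congr (_ - _); apply: eq_bigr => i _.
    by rewrite integral01Z//; exact: cDi.
  move=> t; apply: cvgM; first exact: cvg_cst.
  by apply: cvgD; [exact: ci|exact: cs].
apply: integral01_le => [t|t t01].
  apply: cvgD; first exact: ci.
  apply: cvgM; first exact: cvg_cst.
  by apply: cvgD; [exact: ci|exact: cs].
have /andP[t0 t1] := t01.
set z := p + t *: (y - p).
have -> : t ^+ j * F (p + t *: (y + h - p)) + (-1) * (t ^+ j * F z +
    \sum_(i < n) h ord0 i * (t ^+ j.+1 * partial i F z)) =
  t ^+ j * (F (z + t *: h) - F z - t * \sum_(i < n) h ord0 i * partial i F z).
  rewrite radialD !mulrBr mulN1r opprD addrA; congr (_ - _).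
  rewrite mulrA -exprSr mulr_sumr; apply: eq_bigr => i _; exact: mulrCA.
rewrite normrM ger0_norm ?exprn_ge0//.
apply: le_trans (ler_piMl _ _) _ => //; first exact: exprn_ile1.
apply: le_trans (increment_bound t01 _ _) _.
- by move=> x; exact: dF.
- by move=> i s s01; exact: U.
rewrite ler_wpM2r// sumr_const card_ord -mulr_natl /e' mulrCA ger_pMr//.
by rewrite ler_pdivrMr// mul1r ler_nat.
Qed.

Lemma Ck_radial_mean k j F p : smooth_on setT F -> Ck k setT (radial_mean j F p).
Proof.
elim: k j F => [|k IH] j F sF.
  move=> y _; apply: radial_mean_continuous => x.
  exact: (sF 0).
split=> [y _|v]; first by have [] := radial_mean_diff j p y (sF 1).
have -> : 'D_v (radial_mean j F p) = fun y =>
    \sum_(i < n) v ord0 i * radial_mean j.+1 (partial i F) p y.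
  by apply/funext => y; have [_ ->] := radial_mean_diff j p y (sF 1).
apply: (@Ck_sum R 'rV[R]_n R k setT n (fun i y => v ord0 i * _ y)) => [|i].
  exact: openT.
apply: (@CkZ R 'rV[R]_n R k setT (v ord0 i) _ openT); apply: IH => k'.
by have [_ Ds] := sF k'.+1; exact: Ds.
Qed.

(** The fundamental theorem of calculus for $s\mapsto F(p+s(y-p))$: the coefficients are the means
    of the partial derivatives over the segment from $p$ to $y$, hence smooth in $y$. The whole
    segment has to lie in the domain, so [F] is taken smooth on all of $\mathbb R^n$. *)
Lemma hadamard F p : smooth_on setT F ->
  exists H : 'I_n -> 'rV[R]_n -> R,
    [/\ forall i, smooth_on setT (H i), forall i, H i p = partial i F p &
        forall y, F y = F p + \sum_(i < n) (y ord0 i - p ord0 i) * H i y].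
Proof.
move=> sF; have [dF _] := sF 1.
have cD i : continuous (partial i F) by move=> x; have [_ /(_ _ x)] := sF 1; exact.
exists (fun i => radial_mean 0 (partial i F) p); split.
- by move=> i k; apply: Ck_radial_mean => k'; have [_ Ds] := sF k'.+1; exact: Ds.
- move=> i; rewrite /radial_mean subrr.
  rewrite -[RHS]integral01_cst; congr integral01; apply/funext => t.
  by rewrite expr0 mul1r scaler0 addr0.
- move=> y.
  have dg (s : R) := is_derive_along (@diff_derivable _ _ _ F _ (y - p) (dF (p + s *: (y - p)) I)).
  have ci i : continuous (fun s : R => partial i F (p + s *: (y - p))).
    move=> s; apply: (@continuous_comp _ _ _ (fun s : R => p + s *: (y - p)) (partial i F)).
      exact: radial_continuous.
    exact: cD.
  have ci' i : continuous (fun s : R => (y - p) ord0 i * partial i F (p + s *: (y - p))).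
    by move=> s; apply: cvgM; [exact: cvg_cst|exact: ci].
  have E : (fun s : R => 'D_(y - p) F (p + s *: (y - p))) =
      fun s => \sum_(i < n) (y - p) ord0 i * partial i F (p + s *: (y - p)).
    by apply/funext => s; rewrite derive_rV//; exact: dF.
  have cg : continuous (fun s : R => 'D_(y - p) F (p + s *: (y - p))).
    by rewrite E; exact: continuous_sum.
  have := integral01_derive cg dg; rewrite scale1r scale0r addr0 subrKC E => I01.
  rewrite -[LHS](subrK (F p)) -I01 addrC; congr (_ + _).
  rewrite integral01_sum//; apply: eq_bigr => i _; rewrite integral01Z// !mxE.
  by congr (_ * integral01 _); apply/funext => t; rewrite expr0 mul1r.
Qed.

End hadamard_lemma.

(** * Bump functions *)

Section bumps.
Context {R : realType}.

Lemma Ck_id {V : normedModType R} k (U : set V) : Ck k U (@id V).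
Proof.
case: k => [|k] /=; first by move=> x _; exact: cvg_id.
split=> [x _|v]; first exact: ex_diff.
rewrite (_ : 'D_v id = cst v); first exact: Ck_cst.
by apply/funext => x; rewrite derive_id.
Qed.

Lemma Ck_rV_coord {n} k (U : set 'rV[R]_n) i : open U ->
  Ck k U (fun y : 'rV[R]_n => y ord0 i).
Proof. by move=> oU; exact: (Ck_coord i oU (@Ck_id _ k U)). Qed.

Lemma Ck_prod {V : normedModType R} k (U : set V) m (f : 'I_m -> V -> R) :
  open U -> (forall i, Ck k U (f i)) ->
  Ck k U (fun x => \prod_(i < m) f i x).
Proof.
move=> oU Cf; elim: m f Cf => [|m IH] f Cf.
  rewrite (_ : (fun _ => _) = cst 1); first exact: Ck_cst.
  by apply/funext => x; rewrite big_ord0.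
rewrite (_ : (fun _ => _) = f ord0 \* (fun x => \prod_(i < m) f (lift ord0 i) x)).
  by apply: CkM => //; exact: IH.
by apply/funext => x; rewrite big_ord_recl.
Qed.

(** The parameter [a] nests the bumps: where the one for [a] is nonzero, the one for [a + 1] equals
    1. Squares replace absolute values to keep the factors smooth. *)
Definition box_bump n (p : 'rV[R]_n) (rho a : R) (y : 'rV[R]_n) : R :=
  \prod_(i < n) smooth_step (a - ((y ord0 i - p ord0 i) / rho) ^+ 2).

Lemma Ck_box_bump n (p : 'rV[R]_n) rho a k : Ck k setT (box_bump p rho a).
Proof.
apply: Ck_prod => [|i]; first exact: openT.
apply: (Ck_smooth_step (g := fun y : 'rV[R]_n =>
  a - ((y ord0 i - p ord0 i) / rho) ^+ 2)); first exact: openT.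
have Cl : Ck k setT (fun y : 'rV[R]_n => rho^-1 * (y ord0 i + - p ord0 i)).
  apply: (@CkZ _ _ R k _ rho^-1 (fun y : 'rV[R]_n => y ord0 i + - p ord0 i) openT).
  apply: (@CkD _ _ R k _ (fun y : 'rV[R]_n => y ord0 i) (cst (- p ord0 i)) openT).
    by apply: Ck_rV_coord; exact: openT.
  exact: Ck_cst.
have := CkM openT Cl Cl.
move=> /(CkZ (-1) openT) /(CkD openT (@Ck_cst _ _ _ k setT a)).
apply: Ck_ext; first exact: openT.
by move=> y _ /=; rewrite /GRing.scale/= mulN1r expr2 [_ / rho]mulrC.
Qed.

Lemma box_bump_eq1 n (p y : 'rV[R]_n) rho a :
  (forall i, ((y ord0 i - p ord0 i) / rho) ^+ 2 <= a - 1) -> box_bump p rho a y = 1.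
Proof.
move=> H; rewrite /box_bump big1// => i _; apply: smooth_step1.
by have := H i; lra.
Qed.

Lemma box_bump_neq0 n (p y : 'rV[R]_n) rho a i :
  box_bump p rho a y != 0 -> ((y ord0 i - p ord0 i) / rho) ^+ 2 < a.
Proof.
apply: contraNT; rewrite -leNgt => H.
by rewrite /box_bump (bigD1 i)//= smooth_step0 ?mul0r// subr_le0.
Qed.

(** Two nested bumps are needed later: [psi] cuts functions off, and [chi] restricts attention to
    points around which [psi] is 1. *)
Lemma bump_rV n (U : set 'rV[R]_n) (p : 'rV[R]_n) : open U -> U p ->
  exists (chi psi : 'rV[R]_n -> R) (K : set 'rV[R]_n),
    [/\ smooth_on setT chi, smooth_on setT psi,
        chi p = 1 /\ (forall y, chi y * psi y = chi y),
        compact K /\ K `<=` U &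
        forall y, ~ K y -> psi y = 0].
Proof.
move=> oU Up.
have /nbhs_normP[e /= e0 eU] : nbhs p U by exact: open_nbhs_nbhs.
(* The closed ball of radius [2 * rho] lies in the ball of radius [e], and contains the support of
   [psi], where every $|y_i-p_i|$ is at most $\sqrt2\,\rho$. *)
pose rho := e / 4; have rho0 : 0 < rho by rewrite divr_gt0.
exists (box_bump p rho 1), (box_bump p rho 2), [set y | `|p - y| <= 2 * rho]; split.
- by move=> k; exact: Ck_box_bump.
- by move=> k; exact: Ck_box_bump.
- split; first by apply: box_bump_eq1 => i; rewrite subrr mul0r expr0n subrr.
  move=> y; have [->|c0] := eqVneq (box_bump p rho 1 y) 0; first by rewrite mul0r.
  rewrite (@box_bump_eq1 _ p y rho 2) ?mulr1// => i.
  by have := box_bump_neq0 i c0; lra.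
- split; last first.
    by move=> y /= yp; apply: eU; rewrite /ball_/= (le_lt_trans yp)// /rho; lra.
  apply: bounded_closed_compact.
    exists (`|p| + 2 * rho); split; first exact: num_real.
    move=> x px y /= yp.
    rewrite -[y](subKr p) (le_trans (ler_normB _ _))// ltW// (le_lt_trans _ px)//.
    by rewrite lerD2l.
  rewrite -[X in closed X]/(closed_ball_ Num.norm p (2 * rho)) -closed_ballE.
    exact: closed_ball_closed.
  by rewrite mulr_gt0.
- move=> y yK; apply/eqP; apply/negP => /negP/eqP/eqP b0; apply: yK => /=.
  rewrite [leLHS]/Num.Def.normr/= mx_normrE; apply: bigmax_le => [|[i j] _] /=.
    by rewrite mulr_ge0// ltW.
  rewrite ord1 !mxE distrC.
  have := box_bump_neq0 j b0; rewrite exprMn exprVn ltr_pdivrMr ?exprn_gt0// => H.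
  rewrite -ler_sqr ?nnegrE ?normr_ge0 ?mulr_ge0 ?ltW//.
  rewrite real_normK ?num_real//; apply: lt_trans H _.
  by have := exprn_gt0 2 rho0; lra.
Qed.

End bumps.

(** * Extension by zero from a chart *)

Section smooth_extension.
Context {R : realType} {n : nat} {N : manifold R n}.
Variable c : chart R N n.
Hypotheses (hc : is_chart c) (cc : forall d, charts d -> compatible c d).

(** Every point has a neighbourhood either inside the chart, where a transition map applies, or off
    [C], where [H] is 0. The support is only asked to be closed, so that preimages under the bundle
    projection qualify. *)
Lemma smooth_fun_closed_support (C : set N) (H : N -> R) :
  closed C -> C `<=` cdom c -> (forall q, ~ C q -> H q = 0) ->
  smooth_on (cimg c) (H \o cinv c) -> smooth_fun H.
Proof.
move=> clC Cc H0 sH d ad k; have hd := atlas_chart ad.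
have [oD oI dK _ _] := hd; have [oc _ cK _ _] := hc.
apply: (@Ck_local _ _ _ _ _ _ (H \o cinv d)) => _ [q dq <-].
have [cq|cq] := pselect (cdom c q).
  exists (cfun d @` (cdom d `&` cdom c)); split.
  - exact: chart_openI.
  - by exists q.
  - by [].
  apply: (@Ck_ext _ _ _ _ _ _ ((H \o cinv c) \o (cfun c \o cinv d))).
  + exact: chart_openI.
  + by move=> _ [q' [dq' cq'] <-] /=; rewrite !dK// cK.
  + apply: (@Ck_comp _ _ _ _ _ (cimg c)).
    * exact: chart_openI.
    * by move=> _ [q' [dq' cq'] <-] /=; rewrite !dK//; exists q'.
    * by have [_ h] := cc ad; rewrite setIC; exact: h.
    * exact: sH.
have oC : open (~` C) by exact: closed_openC.
exists (cfun d @` (cdom d `&` ~` C)); split.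
- exact: chart_openI.
- by exists q => //; split=> // /Cc.
- by [].
apply: (@Ck_ext _ _ _ _ _ _ (cst 0)); first exact: chart_openI.
  by move=> _ [q' [dq' cq'] <-] /=; rewrite !dK// H0.
exact: Ck_cst.
Qed.

(** The image of a compact set is compact, and the manifold is Hausdorff. *)
Lemma closed_chart_compact (K : set 'rV[R]_n) : compact K -> K `<=` cimg c ->
  closed (cinv c @` K).
Proof.
move=> cK Kc; have [_ _ _ _ cC] := hc.
apply: compact_closed; first exact: (mfd_hausdorff (mfd_struct N)).
apply: continuous_compact => //; apply: continuous_in_subspaceT => x.
by rewrite inE => /Kc /cC.
Qed.

Definition chart_ext (psi G : 'rV[R]_n -> R) (q : N) : R :=
  if `[< cdom c q >] then psi (cfun c q) * G (cfun c q) else 0.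

Lemma chart_ext_smooth (psi G : 'rV[R]_n -> R) (K : set 'rV[R]_n) :
  compact K -> K `<=` cimg c -> (forall y, ~ K y -> psi y = 0) ->
  smooth_on setT psi -> smooth_on setT G -> smooth_fun (chart_ext psi G).
Proof.
move=> cK Kc psi0 spsi sG; have [oD oI ciK _ _] := hc.
apply: (@smooth_fun_closed_support (cinv c @` K)).
- exact: closed_chart_compact.
- by move=> _ [x /Kc[q cq <-] <-]; rewrite ciK.
- move=> q Kq; rewrite /chart_ext; case: asboolP => // cq.
  rewrite psi0 ?mul0r// => Kcq; apply: Kq; exists (cfun c q) => //; exact: ciK.
- move=> k; apply: (@Ck_ext _ _ _ _ _ _ (psi \* G)) => //.
    by move=> _ [q cq <-]; rewrite /chart_ext /= ciK// asboolT.
  by apply: CkM => //; apply: (@Ck_sub _ _ _ k _ setT).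
Qed.

End smooth_extension.

(** * Local frames of the tangent bundle *)

Section frames.
Context {R : realType} {n : nat} {N : manifold R n}.
Implicit Types (g : Cinf N).

Lemma chart_compat (c : chart R N n) : charts c ->
  forall d, charts d -> compatible c d.
Proof. by move=> ac d ad; exact: atlas_compat ac ad. Qed.

Lemma Cinf_sumE m (F : 'I_m -> Cinf N) q : (\sum_i F i) q = \sum_i F i q.
Proof. by elim/big_rec2 : _ => // i a b _ <-. Qed.

Section chart_frame.
Variables (c : chart R N n) (ac : charts c).
Variables (chi psi : 'rV[R]_n -> R) (K : set 'rV[R]_n).
Hypotheses (schi : smooth_on setT chi) (spsi : smooth_on setT psi).
Hypotheses (chipsi : forall y, chi y * psi y = chi y).
Hypotheses (cK : compact K) (Kc : K `<=` cimg c).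
Hypothesis psi0 : forall y, ~ K y -> psi y = 0.

Let hc : is_chart c := atlas_chart ac.

Let chi0 y : ~ K y -> chi y = 0.
Proof. by move=> /psi0 p0; rewrite -chipsi p0 mulr0. Qed.

(** The local expression of [g], made smooth on all of $\mathbb R^n$ so that Hadamard's lemma
    applies; the arbitrary values of [cinv c] off the chart image are multiplied by 0. *)
Definition cutoff g (y : 'rV[R]_n) : R := psi y * g (cinv c y).

Lemma cutoff_smooth g : smooth_on setT (cutoff g).
Proof.
have [_ oI _ _ _] := hc; move=> k.
apply: Ck_local => y _; have [Iy|Iy] := pselect (cimg c y).
  exists (cimg c); split=> //; apply: (@CkM _ _ _ _ psi (g \o cinv c)) => //.
    exact: Ck_sub (spsi k).
  exact: CinfP.
exists (~` K); split=> //.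
- by apply: closed_openC; exact: compact_closed (@norm_hausdorff _ _) cK.
- by move=> /Kc.
- apply: (@Ck_ext _ _ _ _ _ _ (cst 0)) (@Ck_cst _ _ _ _ _ _).
    by apply: closed_openC; exact: compact_closed (@norm_hausdorff _ _) cK.
  by move=> z Kz; rewrite /cutoff psi0// mul0r.
Qed.

Definition psi_ext (G : 'rV[R]_n -> R) (sG : smooth_on setT G) : Cinf N :=
  mkCinf (chart_ext_smooth hc (chart_compat ac) cK Kc psi0 spsi sG).

Definition chi_ext (G : 'rV[R]_n -> R) (sG : smooth_on setT G) : Cinf N :=
  mkCinf (chart_ext_smooth hc (chart_compat ac) cK Kc chi0 schi sG).

Lemma smooth_cst1 : smooth_on setT (cst (1 : R) : 'rV[R]_n -> R).
Proof. by move=> k; exact: Ck_cst. Qed.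

Lemma smooth_coord i : smooth_on setT (fun y : 'rV[R]_n => y ord0 i).
Proof. by move=> k; apply: Ck_rV_coord; exact: openT. Qed.

Lemma smooth_partial i g : smooth_on setT ('D_(delta_mx ord0 i) (cutoff g)).
Proof. by move=> k; have [_ h] := cutoff_smooth g k.+1; exact: h. Qed.

Let chiN := chi_ext smooth_cst1.
Let psiN := psi_ext smooth_cst1.

Lemma chi_extE G (sG : smooth_on setT G) q :
  chi_ext sG q = chiN q * G (cfun c q).
Proof.
by rewrite /= /chart_ext; case: asboolP => _; rewrite ?mul0r// mulr1.
Qed.

Lemma psi_extE G (sG : smooth_on setT G) q :
  psi_ext sG q = psiN q * G (cfun c q).
Proof.
by rewrite /= /chart_ext; case: asboolP => _; rewrite ?mul0r// mulr1.
Qed.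

Lemma chiN_neq0 q : chiN q != 0 -> cdom c q /\ chi (cfun c q) != 0.
Proof.
by rewrite /= /chart_ext; case: asboolP => cq; rewrite ?eqxx// mulr1.
Qed.

Lemma psiN_cutoff q g : psiN q * cutoff g (cfun c q) = psiN q * (psiN q * g q).
Proof.
have [_ _ ciK _ _] := hc; rewrite /= /chart_ext /cutoff.
by case: asboolP => cq; [rewrite ciK// mulr1|rewrite !mul0r].
Qed.

Lemma near_psi1 y : chi y != 0 -> \near y, psi y = 1.
Proof.
move=> cy; have : \near y, chi y != 0.
  have cchi : {for y, continuous chi} by exact: (schi 0).
  exact: (cvgr_neq0 _ cchi).
by apply: filterS => z cz; apply: (mulfI cz); rewrite chipsi mulr1.
Qed.

(** The cut-off of a product carries one factor [psi] and the product of cut-offs carries two, but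
    near a point with [chi] nonzero [psi] is 1, and elsewhere the prefactor vanishes. *)
Lemma chi_frame_derivation i q :
  is_derivation q (fun g => chiN q * 'D_(delta_mx ord0 i) (cutoff g) (cfun c q)).
Proof.
have d g y v : derivable (cutoff g) y v.
  by apply: diff_derivable; have [h _] := cutoff_smooth g 1; exact: h.
have [->|c0] := eqVneq (chiN q) 0.
  by split=> [a f g|f g]; rewrite !mul0r ?mulr0 ?addr0// mulr0 addr0.
have [cq chiq] := chiN_neq0 c0; have [_ _ ciK _ _] := hc.
split=> [a f g|f g].
  have -> : cutoff (a *: f + g) = (a \*: cutoff f) \+ cutoff g.
    by apply/funext => y; rewrite /cutoff /= mulrDr; congr (_ + _); exact: mulrCA.
  rewrite deriveD//; last exact: derivableZ.
  by rewrite deriveZ// mulrDr [RHS]/GRing.add/=; congr (_ + _); exact: mulrCA.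
have E : \forall y \near cfun c q, cutoff (f * g) y = (cutoff f \* cutoff g) y.
  apply: filterS (near_psi1 chiq) => y p1.
  by rewrite /cutoff /= p1 !mul1r.
rewrite (near_eq_derive _ E) deriveM//.
have p1 : psi (cfun c q) = 1 by exact: nbhs_singleton (near_psi1 chiq).
rewrite /cutoff !p1 !mul1r ciK// /GRing.scale/=; ring.
Qed.

(** The coordinate field $\chi\,\partial_i$, extended by zero. Its smoothness is that of [chi_ext]
    of the partial derivative, transported along [chi_extE]. *)
Definition frame_field i : vfield N :=
  @VField R n N (fun q => mkTangent (chi_frame_derivation i q))
    (fun g => eq_ind _ _ (CinfP (chi_ext (smooth_partial i g))) _
       (funext (chi_extE (smooth_partial i g)))).

(** This is $x=\sum_i x(x_i)\,\partial_i$ for an abstract derivation. Since [x] kills [psiN],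
    factors [psiN] can be inserted freely; [x] is then applied to the Hadamard expansion of [g] at
    [q], whose factors $x_i-x_i(q)$ vanish at [q]. *)
Lemma frame_fieldP q (x : tangent q) g :
  chiN q * x g = \sum_i x (psi_ext (smooth_coord i)) * frame_field i q g.
Proof.
have FE i : frame_field i q g =
    chiN q * 'D_(delta_mx ord0 i) (cutoff g) (cfun c q) by [].
have [c0|c0] := eqVneq (chiN q) 0.
  by rewrite c0 mul0r big1// => i _; rewrite FE c0 mul0r mulr0.
have [cq chiq] := chiN_neq0 c0; have [_ _ ciK _ _] := hc.
have p1 : psi (cfun c q) = 1 by exact: nbhs_singleton (near_psi1 chiq).
have psiq : psiN q = 1 by rewrite /= /chart_ext asboolT// p1 mulr1.
have [_ Lx] := tangentP x.
(* Applying [x] to [chiN * psiN = chiN] leaves [chiN q * x psiN = 0]. *)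
have xpsi : x psiN = 0.
  have E : chiN * psiN = chiN.
    apply/val_inj/funext => z; rewrite /= /GRing.mul/= /chart_ext.
    by case: asboolP => _; rewrite ?mul0r// !mulr1 chipsi.
  have := Lx chiN psiN; rewrite E psiq mulr1 -[LHS]addr0 => /addrI/esym/eqP.
  by rewrite mulf_eq0 (negbTE c0) => /eqP.
have xM h : x (psiN * h) = x h by rewrite Lx xpsi mul0r add0r psiq mul1r.
have [H [sH H1 HE]] := hadamard (cfun c q) (cutoff_smooth g).
pose y0 := cfun c q.
(* One factor [psiN] turns [g] into its cut-off; the other two globalize the coordinates and the
   Hadamard coefficients. *)
have E : psiN * (psiN * (psiN * g)) = cutoff g y0 *: (psiN * psiN) +
    \sum_i (psi_ext (smooth_coord i) - y0 ord0 i *: psiN) * psi_ext (sH i).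
  apply/val_inj/funext => z; rewrite -[RHS]/(cutoff g y0 * (psiN z * psiN z) +
    (\sum_i (psi_ext (smooth_coord i) - y0 ord0 i *: psiN) * psi_ext (sH i)) z).
  rewrite Cinf_sumE -[LHS]/(psiN z * (psiN z * (psiN z * g z))).
  transitivity (psiN z * (psiN z * cutoff g (cfun c z))).
    rewrite -psiN_cutoff//.
  rewrite HE mulrDr mulrDr; congr (_ + _); first by ring.
  rewrite !mulr_sumr; apply: eq_bigr => i _.
  rewrite -[RHS]/((psi_ext (smooth_coord i) z - y0 ord0 i * psiN z) * psi_ext (sH i) z).
  rewrite (psi_extE (smooth_coord i)) (psi_extE (sH i)).
  move: (psiN z) (H i _) (cfun c z _ _) (y0 _ _) => u v w t.
  ring.
rewrite -(xM g) -(xM (_ * _)) -(xM (_ * (_ * _))) E linearD linearZ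
  -[_ (cutoff g y0) _]/(cutoff g y0 * x (psiN * psiN)) Lx xpsi.
rewrite !(mulr0, mul0r, addr0, add0r).
transitivity (chiN q * \sum_i x ((psi_ext (smooth_coord i) - y0 ord0 i *: psiN) *
    psi_ext (sH i))); first by rewrite linear_sum.
rewrite mulr_sumr.
apply: eq_bigr => i _; rewrite Lx linearB linearZ.
rewrite -[_ (y0 ord0 i) _]/(y0 ord0 i * x psiN) xpsi mulr0 subr0 FE -H1.
have -> : (psi_ext (smooth_coord i) - y0 ord0 i *: psiN) q = 0.
  rewrite -[LHS]/(psi_ext (smooth_coord i) q - y0 ord0 i * psiN q).
  by rewrite (psi_extE (smooth_coord i)) psiq mul1r mulr1 subrr.
by rewrite mul0r addr0 (psi_extE (sH i)) psiq mul1r mulrCA.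
Qed.

End chart_frame.

(** The identity holds at every [q], with global functions and fields, so that it can be
    differentiated and not only evaluated at [m]. *)
Lemma local_frame (m : N) :
  exists (chi : Cinf N) (f : 'I_n -> Cinf N) (Y : 'I_n -> vfield N),
    chi m = 1 /\ forall q (x : tangent q) g,
      chi q * x g = \sum_i x (f i) * Y i q g.
Proof.
have [c ac cm] := atlas_cover (mfd_struct N) m.
have [oD oI ciK _ _] := atlas_chart ac.
have Im : cimg c (cfun c m) by exists m.
have [chi [psi [K [schi spsi [chi1 chipsi] [cK Kc] psi0]]]] := bump_rV oI Im.
have H := frame_fieldP ac schi spsi chipsi cK Kc psi0.
do 3 eexists; split; last exact: H.
by rewrite /= /chart_ext asboolT// chi1 mulr1.
Qed.

(** Freeze the coefficients: the field is $\sum_i x(f_i)\,Y_i$ with constants $x(f_i)$. *)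
Lemma vfield_through (m : N) (x : tangent m) : exists X : vfield N, X m = x.
Proof.
have [chi [f [Y [chi1 H]]]] := local_frame m.
have d q : is_derivation q (fun g => \sum_i x (f i) * Y i q g).
  split=> [a u v|u v].
    rewrite mulr_sumr -big_split/=; apply: eq_bigr => i _.
    rewrite (tangentP (Y i q)).1 mulrDr; congr (_ + _); exact: mulrCA.
  rewrite mulr_suml mulr_sumr -big_split/=; apply: eq_bigr => i _.
  by rewrite (tangentP (Y i q)).2 mulrDr mulrA; congr (_ + _); exact: mulrCA.
have s g : smooth_fun (fun q => mkTangent (d q) g).
  have -> : (fun q => mkTangent (d q) g) = \sum_i x (f i) *: vf_act (Y i) g.
    apply/funext => q; rewrite Cinf_sumE.
    by apply: eq_bigr => i _.
  exact: CinfP.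
exists (VField s); apply/val_inj/funext => g /=.
by rewrite -H chi1 mul1r.
Qed.

End frames.

(** * Sections of vector bundles *)

Section vector_valued_Ck.
Context {R : realType}.

Lemma Ck_scalel {V W : normedModType R} k (U : set V) (f : V -> R) (w : W) :
  open U -> Ck k U f -> Ck k U (fun x => f x *: w).
Proof.
move=> oU; elim: k f => [|k IH] f.
  by move=> cf x Ux; apply: cvgZr_tmp; exact: cf.
move=> [df Df]; split=> [x Ux|v]; first by apply: differentiableZl; exact: df.
apply: (@Ck_ext _ _ _ _ _ _ (fun x => 'D_v f x *: w)) (IH _ (Df v)) => // x Ux.
have dfx := df x Ux.
by rewrite deriveE ?diffZl//=; [rewrite -deriveE|exact: differentiableZl].
Qed.

Lemma Ck_of_coord {V : normedModType R} m k (U : set V) (g : V -> 'rV[R]_m) :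
  open U -> (forall i, Ck k U (fun x => g x ord0 i)) -> Ck k U g.
Proof.
move=> oU Cg.
apply: (@Ck_ext _ _ _ _ _ _ (fun x => \sum_(i < m) g x ord0 i *: delta_mx ord0 i)) => //.
  by move=> x _; exact: row_sum_delta.
by apply: Ck_sum => // i; exact: Ck_scalel.
Qed.

Lemma Ck_comp_rV {V : normedModType R} m l k (U : set V) (U' : set 'rV[R]_m)
    (g : V -> 'rV[R]_m) (f : 'rV[R]_m -> 'rV[R]_l) :
  open U -> open U' -> (forall x, U x -> U' (g x)) ->
  Ck k U g -> Ck k U' f -> Ck k U (f \o g).
Proof.
move=> oU oU' gU Cg Cf; apply: Ck_of_coord => // i.
exact: (Ck_comp oU gU Cg (Ck_coord i oU' Cf)).
Qed.

Lemma Ck_row_mx {V : normedModType R} m l k (U : set V) (f : V -> 'rV[R]_m)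
    (g : V -> 'rV[R]_l) :
  open U -> Ck k U f -> Ck k U g -> Ck k U (fun x => row_mx (f x) (g x)).
Proof.
move=> oU Cf Cg; apply: Ck_of_coord => // i.
rewrite (_ : (fun _ => _) =
    match fintype.split i with inl j => fun x => f x ord0 j | inr j => fun x => g x ord0 j end).
  by case: (fintype.split i) => j; exact: Ck_coord.
by apply/funext => x; rewrite mxE; case: (fintype.split i).
Qed.

End vector_valued_Ck.

(** * Sections through a point, and separation by covector fields *)

Section sections_through.
Context {R : realType} {n r : nat} {M : manifold R n}.

Lemma bump_manifold (c : chart R M n) (A : set M) (m : M) :
  charts c -> open A -> cdom c m -> A m ->
  exists (b : Cinf M) (C : set M), [/\ b m = 1, closed C,
    C `<=` cdom c `&` A & forall q, ~ C q -> b q = 0].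
Proof.
move=> ac oA cm Am; have hc := atlas_chart ac; have [_ _ ciK _ _] := hc.
have oU := chart_openI hc oA.
have Um : (cfun c @` (cdom c `&` A)) (cfun c m) by exists m.
have [chi [psi [K [schi _ [chi1 chipsi] [cK KU] psi0]]]] := bump_rV oU Um.
have Kc : K `<=` cimg c by move=> x /KU[q [cq _] <-]; exists q.
have chi0 y : ~ K y -> chi y = 0 by move=> /psi0 p0; rewrite -chipsi p0 mulr0.
have s1 : smooth_on setT (cst (1 : R) : 'rV[R]_n -> R) by move=> k; exact: Ck_cst.
exists (mkCinf (chart_ext_smooth hc (chart_compat ac) cK Kc chi0 schi s1)), (cinv c @` K).
split.
- by rewrite /= /chart_ext asboolT// chi1 mulr1.
- exact: closed_chart_compact.
- by move=> _ [x /KU[q [cq Aq] <-] <-]; rewrite ciK.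
- move=> q Kq /=; rewrite /chart_ext; case: asboolP => // cq.
  rewrite chi0 ?mul0r// => Kcq; apply: Kq; exists (cfun c q) => //; exact: ciK.
Qed.

Variable E : vbundle M r.

Definition local_triv (t : trivialization (fib E) r) :=
  [/\ open (tdom t),
      forall x, tdom t x -> cancel (tfun t x) (tinv t x) /\
                            cancel (tinv t x) (tfun t x) &
      forall c, charts c -> is_chart (triv_chart c t : chart R (tot E) _) /\
        forall d, charts d -> compatible (triv_chart c t : chart R (tot E) _) d].

Lemma local_triv_at (m : M) : exists2 t, local_triv t & tdom t m.
Proof. by have [t [ot tm tK ct]] := vb_trivial E m; exists t. Qed.

Lemma smooth_section (e : forall m, fib E m) :
  (forall m, exists U t (c : chart R M n) (s : M -> 'rV[R]_r),
    [/\ open U /\ U m, U `<=` cdom c `&` tdom t, charts c /\ local_triv t,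
        forall q, U q -> tfun t q (e q) = s q &
        smooth_on (cfun c @` U) (s \o cinv c)]) ->
  smooth_map (fun m => pt (e m)).
Proof.
move=> He; pose F m := pt (e m).
have HF m : exists U t (c : chart R M n) (G : 'rV[R]_n -> 'rV[R]_(n + r)),
    [/\ open U /\ U m, U `<=` cdom c, charts c /\ local_triv t,
      forall q, U q -> cdom (triv_chart c t) (F q) /\
        cfun (triv_chart c t) (F q) = G (cfun c q) & smooth_on (cfun c @` U) G].
  have [U [t [c [s [[oU Um] Uct [ac ht] es ss]]]]] := He m.
  have hc := atlas_chart ac; have [_ _ ciK _ _] := hc.
  exists U, t, c, (fun y => row_mx y (s (cinv c y))); split=> //.
  - by move=> q /Uct[].
  - move=> q Uq; have [cq tq] := Uct _ Uq; split=> //.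
    by rewrite /= es// ciK.
  - have oU' : open (cfun c @` U).
      rewrite (_ : U = cdom c `&` U); first exact: chart_openI.
      by apply/seteqP; split=> [q Uq|q []//]; split=> //; have [] := Uct _ Uq.
    move=> k; apply: (@Ck_row_mx _ _ _ _ _ _ id (s \o cinv c)) => //; exact: Ck_id.
have openU (c : chart R M n) (U : set M) :
    charts c -> open U -> U `<=` cdom c -> open (cfun c @` U).
  move=> ac oU Uc; rewrite (_ : U = cdom c `&` U).
    exact: (chart_openI (atlas_chart ac)).
  by apply/seteqP; split=> [q Uq|q []//]; split=> //; exact: Uc.
have cF : continuous F.
  move=> m; have [U [t [c [G [[oU Um] Uc [ac ht] FG sG]]]]] := HF m.
  have [_ _ cht] := ht; have [htc _] := cht c ac.
  have [_ _ tcK _ tcC] := htc; have [_ _ _ cC _] := atlas_chart ac.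
  have FE q : U q -> F q = (cinv (triv_chart c t) \o (G \o cfun c)) q.
    by move=> Uq; have [cFq e'] := FG q Uq; rewrite /comp -e' (tcK _ cFq).
  have nFE : \forall q \near m, (cinv (triv_chart c t) \o (G \o cfun c)) q = F q.
    by apply: filterS (open_nbhs_nbhs (conj oU Um)) => q /FE.
  have : {for m, continuous ((cinv (triv_chart c t) : _ -> tot E) \o (G \o cfun c))}.
    apply: continuous_comp.
      apply: continuous_comp; first exact/cC/Uc.
      by apply: (sG 0); exists m.
    by apply: tcC; have [cFm e'] := FG m Um; rewrite /comp -e'; exists (F m).
  rewrite /continuous_at /= => h.
  apply: cvg_trans (near_eq_cvg nFE) _.
  by rewrite (FE m Um).
split=> // c1 d ac1 ad k.
have hc1 := atlas_chart ac1; have [_ _ c1K _ _] := hc1.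
apply: (@Ck_local _ _ _ _ _ _ (cfun d \o F \o cinv c1)) => _ [m [c1m dFm] <-].
have [U [t [c [G [[oU Um] Uc [ac ht] FG sG]]]]] := HF m.
have [_ _ cht] := ht; have [htc tcd] := cht c ac; have [_ _ tcK _ _] := htc.
have hd : is_chart d := atlas_chart (ad : charts (M := tot E) d).
have oV : open (cdom c1 `&` (F @^-1` cdom d `&` U)).
  have [od _ _ _ _] := hd; have [oc1 _ _ _ _] := hc1.
  by apply: openI => //; apply: openI => //; apply: open_comp.
exists (cfun c1 @` (cdom c1 `&` (F @^-1` cdom d `&` U))).
have oW : open (cfun c1 @` (cdom c1 `&` (F @^-1` cdom d `&` U))).
  by apply: openU => // q [].
split=> //; first by exists m.
apply: (@Ck_ext _ _ _ _ _ _ ((cfun d \o cinv (triv_chart c t)) \o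
    (G \o (cfun c \o cinv c1)))) => //.
  move=> _ [q [c1q [dFq Uq]] <-]; rewrite /comp c1K//.
  by have [cFq e'] := FG q Uq; rewrite -e' tcK.
apply: (@Ck_comp_rV _ _ _ _ _ _ (cfun (triv_chart c t) @`
    (cdom (triv_chart c t) `&` cdom d))) => //.
- by apply: (chart_openI htc); have [] := hd.
- move=> _ [q [c1q [dFq Uq]] <-]; rewrite /comp c1K//.
  by have [cFq e'] := FG q Uq; rewrite -e'; exists (F q).
- apply: (@Ck_comp_rV _ _ _ _ _ _ (cfun c @` U)) => //.
  + exact: openU.
  + by move=> _ [q [c1q [dFq Uq]] <-]; rewrite /comp c1K//; exists q.
  + have [h _] := atlas_compat ac1 ac.
    apply: Ck_sub (h k) => _ [q [c1q [dFq Uq]] <-]; exists q => //; split=> //.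
    exact: Uc.
- by have [h _] := tcd d ad; exact: h.
Qed.

(** A bump times the section that is constant in a local trivialization. *)
Lemma sec_through (m : M) (w : fib E m) : exists e : sec E, e m = w.
Proof.
have [t ht tm] := local_triv_at m; have [ot tK ct] := ht.
have [c ac cm] := atlas_cover (mfd_struct M) m.
have [b [C [b1 clC CA b0]]] := bump_manifold ac ot cm tm.
pose a := tfun t m w.
have se : smooth_map (fun q => pt (b q *: tinv t q a : fib E q)).
  apply: smooth_section => q; have [Cq|Cq] := pselect (C q).
    have [oc oI ciK _ _] := atlas_chart ac.
    exists (cdom c `&` tdom t), t, c, (fun q => b q *: a); split=> //.
    - by split; [exact: openI|exact: CA].
    - by move=> q' [_ tq']; rewrite linearZ/= (tK _ tq').2.
    - have oU := chart_openI (atlas_chart ac) ot.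
      move=> k; apply: (Ck_scalel (f := b \o cinv c)) => //.
      apply: Ck_sub (CinfP b ac k) => _ [q' [cq' _] <-]; by exists q'.
  (* Off [C] the section is zero, in any trivialization around [q]. *)
  have [t' ht' tq] := local_triv_at q; have [ot' _ _] := ht'.
  have [c' ac' cq] := atlas_cover (mfd_struct M) q.
  have [oc' _ _ _ _] := atlas_chart ac'.
  exists (cdom c' `&` tdom t' `&` ~` C), t', c', (fun=> 0); split=> //.
  - split=> //; apply: openI; [exact: openI|exact: closed_openC].
  - by move=> q' [_ Cq']; rewrite b0// scale0r linear0.
  - by move=> k; exact: Ck_cst.
by exists (Sec se); rewrite /= b1 scale1r (tK _ tm).1.
Qed.

(** The fibre coordinates of a trivialization, multiplied by a bump on the base, are global sections
    of $E^*$. *)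
Lemma dsec_separates (m : M) (w1 w2 : fib E m) :
  (forall eps : dsec E, eps m w1 = eps m w2) -> w1 = w2.
Proof.
have [t ht tm] := local_triv_at m; have [ot tK ct] := ht.
have [c ac cm] := atlas_cover (mfd_struct M) m.
have [b [C [b1 clC CA b0]]] := bump_manifold ac ot cm tm.
have [htc tcd] := ct c ac; have [_ _ ciK _ _] := atlas_chart ac.
move=> H; apply: (can_inj (tK m tm).1); apply/rowP => i.
have lin q : scalar (fun w : fib E q => b q * tfun t q w ord0 i).
  move=> a u v; rewrite linearD linearZ/= !mxE mulrDr; congr (_ + _); exact: mulrCA.
have sm : smooth_fun (fun p : tot E => (mkDual (lin (qE p)) : dual _) (vec p)).
  apply: (smooth_fun_closed_support htc tcd (C := @qE _ _ _ _ E @^-1` C)).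
  - by apply: closed_comp => // p _; exact: (qE_smooth E).1.
  - by move=> p /CA[].
  - by move=> p Cp /=; rewrite b0// mul0r.
  - move=> k; have [_ oI tcK _ _] := htc.
    apply: (@Ck_ext _ _ _ _ _ _ ((comp_Cinf (qE_smooth E) b \o cinv (triv_chart c t)) \*
      (fun w : 'rV[R]_(n + r) => w ord0 (rshift n i)))) => //.
      move=> _ [p cp <-]; rewrite /comp (tcK _ cp) /=.
      by rewrite row_mxKl row_mxEr (ciK _ cp.1).
    apply: CkM => //; last exact: Ck_rV_coord.
    exact: (smooth_fun_chart (CinfP (comp_Cinf (qE_smooth E) b)) htc tcd).
by have := H (@DSec R n r M E (fun q => mkDual (lin q)) sm); rewrite /= b1 !mul1r.
Qed.

End sections_through.

(** * The Lie derivative of Lambda and the symmetry defect *)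

Section evaluation_of_sums.
Context {R : realType}.

Lemma tangent_sumE {n} {N : manifold R n} {q : N} m (v : 'I_m -> tangent q) f :
  (\sum_i v i) f = \sum_i v i f.
Proof. by elim/big_rec2 : _ => // i a b _ <-. Qed.

Lemma dual_sumE {V : lmodType R} m (u : 'I_m -> dual V) w :
  (\sum_i u i) w = \sum_i u i w.
Proof. by elim/big_rec2 : _ => // i a b _ <-. Qed.

End evaluation_of_sums.

(** * Tangent vectors of the total space *)

Section tangent_of_bundle.
Context {R : realType} {n r : nat} {M : manifold R n} {E : vbundle M r}.

Lemma vlift_ell (p : tot E) (w : fib E (qE p)) (eps : dsec E) :
  vlift w (ell eps) = eps (qE p) w.
Proof.
rewrite /= (_ : (fun t => _) = fun t : R => eps (qE p) w * t + eps (qE p) (vec p)).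
  rewrite derive1_lin; [|exact: derivable_id|exact: derivable_cst].
  by rewrite derive1_cst derive1_id mulr1 addr0.
by apply/funext => t; rewrite linearD linearZ/= addrC mulrC.
Qed.

Lemma push_vlift (p : tot E) (w : fib E (qE p)) :
  push (qE_smooth E) (vlift w) = 0.
Proof. by apply/val_inj/funext => f /=; rewrite derive1_cst. Qed.

Lemma push_section (e : sec E) m (x : tangent m) :
  push (qE_smooth E) (p := pt (e m)) (push (sec_smooth e) x) = x.
Proof.
apply/val_inj/funext => f /=; congr (x _); exact/val_inj.
Qed.

Lemma pushB (p : tot E) (u v : tangent p) :
  push (qE_smooth E) (u - v) = push (qE_smooth E) u - push (qE_smooth E) v.
Proof. exact/val_inj. Qed.

Lemma pt_through (p : tot E) : exists (e : sec E) m, p = pt (e m).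
Proof.
case: p => m w; have [e ew] := sec_through w.
by exists e, m; rewrite /pt ew.
Qed.

Lemma dsec_eq (eps1 eps2 : dsec E) :
  (forall m w, eps1 m w = eps2 m w) -> eps1 = eps2.
Proof.
case: eps1 eps2 => [f1 s1] [f2 s2] /= H.
have E12 : f1 = f2.
  by apply: functional_extensionality_dep => m; apply/val_inj/funext => w; exact: H.
by subst f2; congr DSec; exact: Prop_irrelevance.
Qed.

Lemma ellD (eps1 eps2 : dsec E) : ell (dsecD eps1 eps2) = ell eps1 + ell eps2.
Proof. exact/val_inj. Qed.

End tangent_of_bundle.

(** * The Lie derivative of the form Lambda *)

Section lie_derivative_Lambda.
Context {R : realType} {n r : nat} {M : manifold R n} {E : vbundle M r}.
Variables (beta : eform E) (L : form1 (tot E)).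
Hypothesis hL : forall p : tot E, L p = Lambda beta p.
Let q_smooth := qE_smooth E.

Lemma LambdaE p (U : tangent p) : L p U = beta (qE p) (push q_smooth U) (vec p).
Proof. by rewrite hL. Qed.

Definition projects_to (Y : vfield (tot E)) (X : vfield M) :=
  forall p, push q_smooth (Y p) = X (qE p).

Lemma projects_act Y X f : projects_to Y X ->
  vf_act Y (comp_Cinf q_smooth f) = comp_Cinf q_smooth (vf_act X f).
Proof.
by move=> YX; apply/val_inj/funext => p /=; rewrite -YX.
Qed.

Lemma projects_lie Y Z X X' p : projects_to Y X -> projects_to Z X' ->
  push q_smooth (lie Y Z p) = lie X X' (qE p).
Proof.
move=> YX ZX; apply/val_inj/funext => f.
rewrite -[LHS]/(Y p (vf_act Z (comp_Cinf q_smooth f)) -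
  Z p (vf_act Y (comp_Cinf q_smooth f))).
rewrite (projects_act f YX) (projects_act f ZX).
rewrite -[LHS]/(push q_smooth (Y p) (vf_act X' f) - push q_smooth (Z p) (vf_act X f)).
by rewrite YX ZX.
Qed.

Lemma projects_Lambda Y X : projects_to Y X ->
  form1_app L Y = ell (contract beta X).
Proof.
move=> YX; apply/val_inj/funext => p.
by rewrite -[LHS]/(L p (Y p)) LambdaE YX.
Qed.

(* The value at p of (L_Y L)(Z). *)
Definition lie_form1 (Y Z : vfield (tot E)) (p : tot E) : R :=
  Y p (form1_app L Z) - L p (lie Y Z p).

(** A local frame on [M] gives $(\chi\circ q_E)\,\Lambda_\beta=\sum_i g_i\,\mathbf d(f_i\circ q_E)$.
    In the Lie derivative along [Y] the terms $Y(Z(f_i\circ q_E))$ cancel, and $Y(f_i\circ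
    q_E)=X(f_i)\circ q_E$, so that [Z] enters through its projection alone. *)
Lemma lie_form1_tensorial (Y Z Z' : vfield (tot E)) (X : vfield M) p : projects_to Y X ->
  push q_smooth (Z p) = push q_smooth (Z' p) ->
  lie_form1 Y Z p = lie_form1 Y Z' p.
Proof.
move=> YX; have [chi [f [F [chi1 HF]]]] := local_frame (qE p).
pose g i := ell (contract beta (F i)).
pose fq i := comp_Cinf q_smooth (f i).
have betaF q (x : tangent q) w :
    chi q * beta q x w = \sum_i beta q (F i q) w * x (f i).
  have -> : chi q * beta q x w = beta q (chi q *: x) w by rewrite linearZ.
  have -> : chi q *: x = \sum_i x (f i) *: F i q.
    apply/val_inj/funext => h; rewrite -[LHS]/(chi q * x h) HF.
    exact/esym/(tangent_sumE (fun i => x (f i) *: F i q)).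
  rewrite linear_sum dual_sumE; apply: eq_bigr => i _.
  by rewrite linearZ [RHS]mulrC.
have LE Z0 : comp_Cinf q_smooth chi * form1_app L Z0 =
    \sum_i g i * vf_act Z0 (fq i).
  apply/val_inj/funext => p'; rewrite -[RHS]/((\sum_i g i * vf_act Z0 (fq i)) p').
  rewrite Cinf_sumE -[LHS]/(chi (qE p') * L p' (Z0 p')) LambdaE betaF.
  by [].
(* An explicit formula in terms of the projection of [Z0 p]; the last term is there because [chi]
   need not be constant near the base point. *)
suff K Z0 : lie_form1 Y Z0 p =
    \sum_i (Y p (g i) * push q_smooth (Z0 p) (f i) +
      g i p * push q_smooth (Z0 p) (vf_act X (f i))) -
    Y p (comp_Cinf q_smooth chi) * beta (qE p) (push q_smooth (Z0 p)) (vec p).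
  by move=> ZZ; rewrite !K ZZ.
have chip : comp_Cinf q_smooth chi p = 1 by exact: chi1.
have [_ LY] := tangentP (Y p).
have := LY (comp_Cinf q_smooth chi) (form1_app L Z0).
rewrite chip mul1r LE => E1.
have E2 : L p (lie Y Z0 p) =
    \sum_i (g i p * Y p (vf_act Z0 (fq i)) - g i p * Z0 p (vf_act Y (fq i))).
  rewrite LambdaE -[LHS]mul1r -chi1 betaF; apply: eq_bigr => i _.
  by rewrite -mulrBr.
rewrite /lie_form1 E2.
have -> : Y p (form1_app L Z0) = Y p (\sum_i g i * vf_act Z0 (fq i)) -
    Y p (comp_Cinf q_smooth chi) * L p (Z0 p).
  by rewrite E1 addrC addKr.
rewrite LambdaE addrAC; congr (_ - _).
transitivity (\sum_i Y p (g i * vf_act Z0 (fq i)) -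
  \sum_i (g i p * Y p (vf_act Z0 (fq i)) - g i p * Z0 p (vf_act Y (fq i)))).
  by rewrite linear_sum.
rewrite -sumrB; apply: eq_bigr => i _; rewrite LY (projects_act _ YX).
rewrite -[vf_act Z0 (fq i) p]/(push q_smooth (Z0 p) (f i)).
rewrite -[Z0 p (comp_Cinf _ _)]/(push q_smooth (Z0 p) (vf_act X (f i))).
by rewrite opprB [X in _ + X = _]addrC addrA addrK.
Qed.

End lie_derivative_Lambda.

(** * The symmetry defect and the two implications *)

Section symmetry.
Context {R : realType} {n r : nat} {M : manifold R n} {E : vbundle M r}.
Variables (br : dorfman E) (Xi : gamma E -> linear_section E).
Variable D : gamma E -> cogamma E -> cogamma E.
Hypothesis HD : is_dual_derivation br D.
Hypothesis HXi : forall (nu : gamma E) (e : sec E) (m : M),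
  let tau := D nu (e, form1_0 M) in
  Xi nu (pt (e m)) =
  (push (sec_smooth e) (nu.1 m), diff_at (pt (e m)) (ell nu.2))
  - up (p := pt (e m)) (tau.1 m) (tau.2 m).
Variables (beta : eform E) (L : form1 (tot E)).
Hypothesis hL : forall p : tot E, L p = Lambda beta p.
Let q_smooth := qE_smooth E.

Let D1 (nu : gamma E) (e : sec E) (m : M) : fib E m := (D nu (e, form1_0 M)).1 m.
Let D2 (nu : gamma E) (e : sec E) (m : M) : cotangent m := (D nu (e, form1_0 M)).2 m.

Lemma lift_vf (nu : gamma E) (e : sec E) m : ls_vf (Xi nu) (pt (e m)) =
  push (sec_smooth e) (nu.1 m) - @vlift _ _ _ _ _ (pt (e m)) (D1 nu e m).
Proof.
by have := congr1 fst (HXi nu e m).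
Qed.

Lemma lift_form (nu : gamma E) (e : sec E) m (U : tangent (pt (e m))) :
  ls_form (Xi nu) (pt (e m)) U = U (ell nu.2) - D2 nu e m (push q_smooth U).
Proof.
have := congr1 snd (HXi nu e m); rewrite -[LHS]/(ls_form (Xi nu) (pt (e m))) => ->.
by [].
Qed.

Lemma lift_projects (nu : gamma E) : projects_to (ls_vf (Xi nu)) nu.1.
Proof.
move=> p; have [e [m ->]] := pt_through p.
by rewrite lift_vf pushB push_vlift subr0 push_section.
Qed.

Lemma lift_vf_ell (nu : gamma E) (eps : dsec E) (e : sec E) m :
  ls_vf (Xi nu) (pt (e m)) (ell eps) =
  nu.1 m (comp_Cinf (sec_smooth e) (ell eps)) - eps m (D1 nu e m).
Proof.
rewrite lift_vf -[LHS]/(push (sec_smooth e) (nu.1 m) (ell eps) -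
  @vlift _ _ _ _ _ (pt (e m)) (D1 nu e m) (ell eps)).
by rewrite vlift_ell.
Qed.

(** Here $\Lambda_\beta$ of the lift of [nu'] is the linear function of $\mathbf i_{X'}\beta$. The
    value depends on [nu'] only through its vector field part, which both implications exploit. *)
Lemma lie_form1_lift (nu nu' : gamma E) (e : sec E) m :
  lie_form1 L (ls_vf (Xi nu)) (ls_vf (Xi nu')) (pt (e m)) =
  nu.1 m (comp_Cinf (sec_smooth e) (ell (contract beta nu'.1)))
  - beta m (nu'.1 m) (D1 nu e m) - beta m (lie nu.1 nu'.1 m) (e m).
Proof.
rewrite /lie_form1 (projects_Lambda hL (lift_projects nu')) lift_vf_ell.
by rewrite (LambdaE hL) (projects_lie _ (lift_projects nu) (lift_projects nu')).
Qed.

Lemma dual_derivationE (nu nu' : gamma E) (e : sec E) m :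
  nu.1 m (comp_Cinf (sec_smooth e) (ell nu'.2)) =
  nu'.2 m (D1 nu e m) + D2 nu e m (nu'.1 m) + (br nu nu').2 m (e m).
Proof.
have p0 nu0 : pairing nu0 (e, form1_0 M) = comp_Cinf (sec_smooth e) (ell nu0.2).
  by apply/val_inj/funext => q; exact: addr0.
have := HD nu nu' (e, form1_0 M); rewrite !p0 => /(congr1 (fun f : Cinf M => f m)).
exact.
Qed.

(** Subtract the duality identities for [(nu, nu')] and for their images under [Phi_eform beta]; the
    terms with [beta] assemble to the Lie derivative by [lie_form1_lift]. *)
Lemma symmetry_defect (nu nu' : gamma E) (e : sec E) m :
  (br (Phi_eform beta nu) (Phi_eform beta nu')).2 m (e m) -
  (Phi_eform beta (br nu nu')).2 m (e m) =
  lie_form1 L (ls_vf (Xi nu)) (ls_vf (Xi nu')) (pt (e m))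
  - (D2 (Phi_eform beta nu) e m (nu'.1 m) - D2 nu e m (nu'.1 m))
  - ((Phi_eform beta nu').2 m (D1 (Phi_eform beta nu) e m)
     - (Phi_eform beta nu').2 m (D1 nu e m)).
Proof.
have H1 := dual_derivationE nu nu' e m.
have H2 := dual_derivationE (Phi_eform beta nu) (Phi_eform beta nu') e m.
rewrite lie_form1_lift.
have H3 : (Phi_eform beta (br nu nu')).2 m (e m) =
    (br nu nu').2 m (e m) + beta m (lie nu.1 nu'.1 m) (e m).
  by rewrite -(dbr_anchor br).
have H4 w : (Phi_eform beta nu').2 m w = nu'.2 m w + beta m (nu'.1 m) w by [].
have H5 : (Phi_eform beta nu).1 m (comp_Cinf (sec_smooth e) (ell (Phi_eform beta nu').2)) =
    nu.1 m (comp_Cinf (sec_smooth e) (ell nu'.2)) +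
    nu.1 m (comp_Cinf (sec_smooth e) (ell (contract beta nu'.1))).
  rewrite -[RHS](linearD (nu.1 m)); congr (nu.1 m _); exact/val_inj.
rewrite H5 H1 in H2; rewrite H3 !H4; rewrite H4 in H2.
set a := nu.1 m _ in H2 *.
rewrite -[(Phi_eform beta nu').1]/(nu'.1) in H2.
move: H2; move: (br (Phi_eform _ _) _).2 => b.
lra.
Qed.

Variables (dL : form2 (tot E)) (hdL : is_extd L dL).

(** In $\mathbf d\Lambda_\beta(Y,Z)$ the term $Z(\Lambda_\beta(Y))=Z(\ell_{\mathbf i_X\beta})$
    cancels against the summand that [Phi_eform beta] adds to the linear function in the lift. *)
Lemma lift_compat_at (nu : gamma E) (e : sec E) m (Z : vfield (tot E)) :
  (Phi_form2 (form2N dL) (Xi nu (pt (e m)))).2 (Z (pt (e m))) =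
  (Xi (Phi_eform beta nu) (pt (e m))).2 (Z (pt (e m))) <->
  lie_form1 L (ls_vf (Xi nu)) Z (pt (e m)) =
  D2 (Phi_eform beta nu) e m (push q_smooth (Z (pt (e m)))) -
  D2 nu e m (push q_smooth (Z (pt (e m)))).
Proof.
set p := pt (e m).
rewrite -[(Phi_form2 _ _).2 _]/(ls_form (Xi nu) p (Z p) - dL p (ls_vf (Xi nu) p) (Z p)).
rewrite -[(Xi (Phi_eform beta nu) p).2 _]/(ls_form (Xi (Phi_eform beta nu)) p (Z p)).
rewrite !lift_form hdL (projects_Lambda hL (lift_projects nu)) ellD.
rewrite (linearD (Z p) (ell nu.2)) /= /lie_form1; split; lra.
Qed.

Lemma symmetry_lift (nu : gamma E) :
  (forall nu', br (Phi_eform beta nu) (Phi_eform beta nu') =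
    Phi_eform beta (br nu nu')) ->
  forall p, Phi_form2 (form2N dL) (Xi nu p) = Xi (Phi_eform beta nu) p.
Proof.
move=> sym p; have [e [m ->]] := pt_through p.
have K nu' := symmetry_defect nu nu' e m.
have D1E : D1 (Phi_eform beta nu) e m = D1 nu e m.
  apply: dsec_separates => eps.
  (* Doubling the covector part changes only the term that pairs [eps] with the difference of the
     two [D1], so that this pairing vanishes. *)
  have K1 := K (nu.1, eps); have K2 := K (nu.1, dsecD eps eps).
  rewrite sym subrr in K1; rewrite sym subrr in K2.
  have lE : lie_form1 L (ls_vf (Xi nu)) (ls_vf (Xi (nu.1, dsecD eps eps))) (pt (e m)) =
      lie_form1 L (ls_vf (Xi nu)) (ls_vf (Xi (nu.1, eps))) (pt (e m)).
    by rewrite !lie_form1_lift.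
  rewrite lE in K2.
  have P1 w : (Phi_eform beta (nu.1, eps)).2 m w = eps m w + beta m (nu.1 m) w by [].
  have P2 w : (Phi_eform beta (nu.1, dsecD eps eps)).2 m w =
    eps m w + eps m w + beta m (nu.1 m) w by [].
  rewrite !P1 in K1; rewrite !P2 in K2.
  rewrite -[(nu.1, eps).1]/(nu.1) in K1; rewrite -[(nu.1, dsecD _ _).1]/(nu.1) in K2.
  lra.
have E1 : ls_vf (Xi (Phi_eform beta nu)) (pt (e m)) = ls_vf (Xi nu) (pt (e m)).
  by rewrite !lift_vf D1E.
apply: (congr2 pair); first exact: esym E1.
apply/val_inj/funext => U; have [Z <-] := vfield_through U.
(* By tensoriality [Z] may be replaced by the lift of any [nu'] whose vector field part has the same
   projection at [m]; [nu.2] merely fills the covector slot. *)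
apply/lift_compat_at; have [X' X'm] := vfield_through (push q_smooth (Z (pt (e m)))).
have := K (X', nu.2); rewrite sym subrr D1E subrr subr0.
rewrite -X'm => /esym/eqP; rewrite subr_eq0 => /eqP <-.
apply: (lie_form1_tensorial hL (lift_projects nu)).
by rewrite lift_projects.
Qed.

Lemma lift_symmetry (nu nu' : gamma E) :
  (forall p, Phi_form2 (form2N dL) (Xi nu p) = Xi (Phi_eform beta nu) p) ->
  br (Phi_eform beta nu) (Phi_eform beta nu') = Phi_eform beta (br nu nu').
Proof.
move=> comm; rewrite [LHS]surjective_pairing [RHS]surjective_pairing.
(* The components in $TM$ are both the Lie bracket of the anchors, so only the covector components
   remain. *)
congr pair; first by rewrite /= !dbr_anchor.
apply: dsec_eq => m w; have [e <-] := sec_through w.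
apply/eqP; rewrite -subr_eq0; apply/eqP; rewrite symmetry_defect.
have E1 : ls_vf (Xi nu) (pt (e m)) = ls_vf (Xi (Phi_eform beta nu)) (pt (e m)).
  by have := congr1 fst (comm (pt (e m))).
(* Equal vector fields act equally on the linear functions [ell eps], and the defect sees [D1] only
   through such pairings. *)
have D1E (eps : dsec E) : eps m (D1 (Phi_eform beta nu) e m) = eps m (D1 nu e m).
  have := congr1 (fun U : tangent (pt (e m)) => U (ell eps)) E1.
  by rewrite !lift_vf_ell => /addrI/oppr_inj ->.
rewrite D1E subrr subr0.
(* Testing the covector parts on the lift of [nu'] turns the Lie derivative into the very difference
   of the [D2] that the defect subtracts. *)
have /lift_compat_at -> : (Phi_form2 (form2N dL) (Xi nu (pt (e m)))).2 (ls_vf (Xi nu') (pt (e m))) =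
  (Xi (Phi_eform beta nu) (pt (e m))).2 (ls_vf (Xi nu') (pt (e m))).
  by rewrite comm.
by rewrite lift_projects subrr.
Qed.

End symmetry.

Theorem theorem7p1 (R : realType) (n r : nat) (M : manifold R n)
    (E : vbundle M r) (br : dorfman E)
    (Xi : gamma E -> linear_section E) (hXi : is_lift br Xi)
    (beta : eform E)
    (L : form1 (tot E)) (hL : forall p : tot E, L p = Lambda beta p)
    (dL : form2 (tot E)) (hdL : is_extd L dL) :
  (forall nu1 nu2 : gamma E,
      br (Phi_eform beta nu1) (Phi_eform beta nu2) =
      Phi_eform beta (br nu1 nu2)) <->
  (forall (nu : gamma E) (p : tot E),
      Phi_form2 (form2N dL) (Xi nu p) = Xi (Phi_eform beta nu) p).
Proof.
have [D HD HXi] := hXi; split=> [sym nu|comm nu1 nu2].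
  exact: (symmetry_lift HD HXi hL hdL (sym nu)).
exact: (lift_symmetry HD HXi hL hdL nu2 (comm nu1)).
Qed.
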